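(* Let $\zeta\in\mathbb{C}\setminus\mathbb{R}$ be a $3$rd, $4$th or $6$th root of unity. Then for any Pisot number $\beta$ and any $\xi,\eta_1,\eta_2\in\mathbb{Q}(\zeta,\beta)$ with $\eta_1/\eta_2\notin\mathbb{R}$, the associated rotational beta transformation system $(\mathcal{X},T)$ is sofic.
   Context: Let $\mathcal{L}=\mathbb{Z}\eta_1+\mathbb{Z}\eta_2$ be the lattice in $\mathbb{C}$ generated by $\eta_1,\eta_2$, and let $\mathcal{X}=\{\xi+x\eta_1+y\eta_2 : x\in[0,1),\ y\in[0,1)\}$, a fundamental domain of $\mathcal{L}$. The rotational beta transformation $T:\mathcal{X}\to\mathcal{X}$ is $T(z)=\beta\zeta z-d(z)$, where $d(z)$ is the unique element of $\mathcal{L}$ with $\beta\zeta z\in\mathcal{X}+d(z)$. The expansion of $z\in\mathcal{X}$ is the sequence $d_1d_2\dots$ with $d_n=d(T^{n-1}(z))$. $\partial(\mathcal{X})$ denotes the boundary of $\mathcal{X}$. The two open segments of $\partial(\mathcal{X})$ from $\xi+\eta_1$ to $\xi+\eta_1+\eta_2$ and from $\xi+\eta_2$ to $\xi+\eta_1+\eta_2$ lie outside $\mathcal{X}$; for these segments the images by $T$ are defined by an infinitesimally small perturbation, e.g. for the first one takes the image of the segment connecting $\xi+\eta_1(1-\varepsilon)$ and $\xi+\eta_1(1-\varepsilon)+\eta_2$ for an infinitesimally small $\varepsilon>0$ (and similarly for the second). For $n<0$, $T^{n}$ of a set denotes its preimage under $T^{-n}$. Symbolic system: let $\mathcal{A}=\{d(z):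 z\in\mathcal{X}\}$, let $\mathcal{A}^*$ be the set of finite words over $\mathcal{A}$ and $\mathcal{A}^{\mathbb{Z}}$ the set of bi-infinite words. A word $w\in\mathcal{A}^*$ is admissible if it appears (as a block of consecutive letters) in the expansion $d_1d_2\dots$ of some $z\in\mathcal{X}\setminus\bigcup_{n=-\infty}^{\infty}T^n(\partial(\mathcal{X}))$. Let $\mathcal{X}_T=\{(w_j)\in\mathcal{A}^{\mathbb{Z}} : w_jw_{j+1}\cdots w_k \text{ is admissible for all } (j,k)\in\mathbb{Z}^2 \text{ with } j\le k\}$, with the shift $s((w_j))=(w_{j+1})$. The system $(\mathcal{X}_T,s)$, or simply $(\mathcal{X},T)$, is called sofic if there is a finite directed graph $G$ with edges labeled by $\mathcal{A}$ such that for each $w\in\mathcal{X}_T$ there is a bi-infinite path in $G$ labeled $w$, and vice versa (the label sequence of every bi-infinite path in $G$ belongs to $\mathcal{X}_T$). A Pisot number is a real algebraic integer greater than $1$ all of whose other Galois conjugates have absolute value less than $1$. *)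

(* Defs.v *)
From HB Require Import structures.
From mathcomp Require Import all_boot all_order all_algebra.
From mathcomp Require Import all_classical all_reals all_analysis.
From mathcomp Require Export complex.
Set Implicit Arguments.
Unset Strict Implicit.
Unset Printing Implicit Defensive.
Import Order.TTheory GRing.Theory Num.Theory numFieldNormedType.Exports.
Local Open Scope classical_set_scope.
Local Open Scope ring_scope.
Local Open Scope complex_scope.

Section NumberTheory.
Variable R : realType.

Definition galois_conjugates (x y : R[i]) :=
  exists p : {poly rat}, [/\ p \is monic, irreducible_poly p,
    root (map_poly ratr p) x & root (map_poly ratr p) y].

Definition pisot (beta : R) :=
  [/\ 1 < beta, integralOver (intr : int -> R) beta &
      forall y : R[i], galois_conjugates beta%:C y -> y != beta%:C ->
        `|y| < 1].

(* Smallest subfield containing S; [divring_closed] means: contains 1 and is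
   closed under subtraction and division. *)
Definition field_generated (S : set R[i]) : set R[i] :=
  [set z | forall F : {pred R[i]}, GRing.divring_closed F ->
    (forall s, S s -> s \in F) -> z \in F].

End NumberTheory.

Record labeled_graph (L : Type) := LabeledGraph {
  vertex : finType;
  edge : finType;
  source : edge -> vertex;
  target : edge -> vertex;
  label : edge -> L }.

Definition biinfinite_path (L : Type) (G : labeled_graph L)
    (p : int -> edge G) :=
  forall i : int, target (p i) = source (p (i + 1)).

(* A is the alphabet, S a set of bi-infinite words over A. *)
Definition sofic (L : Type) (A : set L) (S : set (int -> L)) :=
  exists G : labeled_graph L, (forall e : edge G, A (label e)) /\
    forall w : int -> L,
      S w <-> exists2 p : int -> edge G,
                biinfinite_path p & forall i, label (p i) = w i.

Section RotationalBeta.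
Variables (R : realType) (beta : R) (zeta xi eta1 eta2 : R[i]).

Definition lattice : set R[i] :=
  [set z | exists m n : int, z = m%:~R * eta1 + n%:~R * eta2].

Definition fundamental_domain : set R[i] :=
  [set z | exists x y : R, [/\ 0 <= x < 1, 0 <= y < 1 &
    z = xi + x%:C * eta1 + y%:C * eta2]].

(* The default value 0 is never used when eta1 and eta2 are linearly
   independent over R: the translation vector then exists and is unique. *)
Definition digit (z : R[i]) : R[i] :=
  xget 0 [set l | lattice l /\ fundamental_domain (beta%:C * zeta * z - l)].

Definition rbeta_map (z : R[i]) : R[i] := beta%:C * zeta * z - digit z.

(* The n-th letter of the expansion of z, numbered from 0. *)
Definition expansion (z : R[i]) (n : nat) : R[i] := digit (iter n rbeta_map z).

(* R[i]^o carries the topology given by the complex modulus. *)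
Definition domain_boundary : set R[i] :=
  let X : set (R[i]^o) := fundamental_domain in closure X `\` interior X.

(* Image of the part of S on the open segment from xi + a to xi + a + b, which
   lies outside the domain: it is the limit, as e decreases to 0, of the images
   of the points moved to the segment from xi + (1 - e) a to
   xi + (1 - e) a + b. *)
Definition side_image (a b : R[i]) (S : set R[i]) : set R[i] :=
  [set w | exists t : R, [/\ 0 < t < 1, S (xi + a + t%:C * b) &
    (rbeta_map (xi + (1 - e)%:C * a + t%:C * b) : R[i]^o)
      @[e --> (0 : R)^'+] --> (w : R[i]^o)]].

(* The images of the corners xi + eta1, xi + eta2 and xi + eta1 + eta2 are left
   undefined. *)
Definition rbeta_image (S : set R[i]) : set R[i] :=
  rbeta_map @` (S `&` fundamental_domain)
  `|` side_image eta1 eta2 S `|` side_image eta2 eta1 S.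

(* T^n(S): forward image for n >= 0; for n = - k.+1, preimage under T^(k.+1). *)
Definition rbeta_power (n : int) (S : set R[i]) : set R[i] :=
  match n with
  | Posz k => iter k rbeta_image S
  | Negz k => [set z | fundamental_domain z /\ S (iter k.+1 rbeta_map z)]
  end.

Definition alphabet : set R[i] := digit @` fundamental_domain.

Definition admissible (w : seq R[i]) :=
  exists2 z : R[i],
    (fundamental_domain `\` \bigcup_n rbeta_power n domain_boundary) z
    & exists k : nat, w = mkseq (fun i => expansion z (k + i)%N) (size w).

Definition rbeta_shift_space : set (int -> R[i]) :=
  [set w | (forall j : int, alphabet (w j)) /\
    forall j k : int, j <= k ->
      admissible (mkseq (fun i => w (j + i%:Z)) `|k - j|%N.+1)].

Definition rbeta_sofic := sofic alphabet rbeta_shift_space.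

End RotationalBeta.

(* Main.v *)
Require Import Defs.
From mathcomp Require Import all_boot all_order all_algebra.
From mathcomp Require Import all_classical all_reals all_analysis.
From mathcomp Require Import zify ring lra separable.
From mathcomp Require polyorder polyrcf.
Set Implicit Arguments.
Unset Strict Implicit.
Unset Printing Implicit Defensive.
Import Order.TTheory GRing.Theory Num.Theory.
Local Open Scope classical_set_scope.
Local Open Scope ring_scope.
Local Open Scope complex_scope.

(** Write P for the interior of the parallelogram and, for a letter d, call
    z |-> beta zeta z - d the branch of d.

    A word w_0 ... w_(n-1) over the lattice is admissible exactly when some
    orbit z_0, ..., z_n with z_(i+1) = beta zeta z_i - w_i stays in P
    ([admissible_chain], [chain_admissible]).  An expansion of a generic point
    gives such an orbit because the orbit avoids the boundary.  Conversely the
    conditions on z_0 are open, and the forward images and preimages of the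
    boundary lie on countably many lines.  A parabolic arc starting at z_0
    meets each line finitely often, hence carries a generic point.

    So the future of a word is determined by the set of possible end points
    z_n.  This set is the intersection of P with half-planes: the images of the
    four sides of P under compositions of branches.  The branch of d sends the
    half-plane { z | phi (u z) > c } to the one with normal u zeta^(-1) and
    threshold beta c - phi (u zeta^(-1) d).  The normals stay in a finite set
    since zeta is a root of unity.  If |c| exceeds the bound of |phi (u z)| on
    P, then the half-plane contains P or misses it, so it can be forgotten as
    long as the set is nonempty.  Only bounded thresholds have to be remembered,
    and these are finitely many ([pisot_finite_orbits]): when phi is the
    coordinate along zeta in the basis (1, zeta), they all lie in Q(beta), with
    a common denominator, and the recursion c |-> beta c - e contracts every
    conjugate of c but c itself, because beta is a Pisot number.  A set of
    algebraic integers of Q(beta) all of whose conjugates are bounded is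
    finite.  Here the order 3, 4 or 6 of zeta enters: it makes zeta quadratic
    over Q with integral trace, so that Q(zeta, beta) = Q(beta) + Q(beta) zeta
    and phi takes values in Q(beta) on it.

    Finitely many half-planes give finitely many polygons; they are the
    vertices of a graph whose finite paths spell the admissible words
    ([path_of_chain], [chain_of_path]).  A compactness argument
    ([sofic_of_windows]) passes from finite words to bi-infinite ones. *)

(** * Integers of a Pisot field with bounded conjugates *)

(** A nonzero rational polynomial of least degree vanishing at x is irreducible
    and generates the ideal of all polynomials vanishing at x. *)
Lemma exists_irreducible_poly_rat (F : numFieldType) (x : F) :
  integralOver (intr : int -> F) x ->
  exists q : {poly rat}, [/\ irreducible_poly q, root (map_poly ratr q) x &
    forall r : {poly rat}, root (map_poly ratr r) x -> q %| r].
Proof.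
move=> [P Pmon Px].
pose ann n := `[< exists q : {poly rat},
  [/\ q != 0, root (map_poly ratr q) x & size q = n] >].
have ex : exists n, ann n.
  exists (size (map_poly intr P : {poly rat})); apply/asboolP.
  exists (map_poly intr P); split => //; first exact/monic_neq0/monic_map.
  rewrite -map_poly_comp (eq_map_poly (g := intr)) // => z /=.
  by rewrite rmorph_int.
have [n /asboolP[q [q0 qx qn]] nmin] := ex_minnP ex.
have min (r : {poly rat}) : r != 0 -> root (map_poly ratr r) x ->
    (size q <= size r)%N.
  by move=> r0 rx; rewrite qn; apply: nmin; apply/asboolP; exists r.
have dvd (r : {poly rat}) : root (map_poly ratr r) x -> q %| r.
  move=> rx; apply: contraT; rewrite /Pdiv.Field.dvdp => mod0.
  have := min _ mod0; rewrite leqNgt ltn_modp q0; apply.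
  move: rx; rewrite {1}(divp_eq r q) rmorphD rmorphM /= /root hornerD hornerM.
  by rewrite (eqP qx) mulr0 add0r.
exists q; split=> //; split=> [|d d1 /dvdpP[e qe]].
  rewrite ltnNge; apply: contraL qx => /size1_polyC qc.
  move: q0; rewrite qc polyC_eq0 map_polyC /root hornerC fmorph_eq0.
  by [].
have [d0 e0] : d != 0 /\ e != 0.
  by move: q0; rewrite qe mulf_eq0 negb_or => /andP[-> ->].
move: (qx); rewrite qe rmorphM /= rootM => /orP[/(min _ e0)|/dvd].
  rewrite qe size_mul //; move: d1 d0 e0; rewrite -!size_poly_gt0.
  by case: (size d) => [|[|k]] // _ _ _; rewrite addnS /= addnS ltnNge leq_addr.
by move=> qd; rewrite /eqp -qe qd andbT qe dvdp_mull.
Qed.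

(** Gauss's lemma: the minimal polynomial over Q divides a monic integer
    polynomial, so up to a unit it is itself a monic integer polynomial. *)
Lemma exists_irreducible_poly_int (F : numFieldType) (x : F) :
  integralOver (intr : int -> F) x ->
  exists p : {poly int}, [/\ p \is monic,
    irreducible_poly (map_poly intr p : {poly rat}) &
    root (map_poly intr p) x].
Proof.
move=> xint; have [q [qirr qx qmin]] := exists_irreducible_poly_rat xint.
have [P Pmon Px] := xint.
have intrE (r : {poly int}) :
    map_poly ratr (map_poly intr r : {poly rat}) = map_poly intr r :> {poly F}.
  rewrite -map_poly_comp (eq_map_poly (g := intr)) // => z /=.
  by rewrite rmorph_int.
have /dvdpP_rat_int[p [a a0 qp] [r Pr]] : q %| map_poly intr P.
  by apply: qmin; rewrite intrE.
have lead1 : lead_coef p * lead_coef r = 1.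
  by rewrite -lead_coefM -Pr; apply/eqP.
pose u := lead_coef r.
have lu : lead_coef (u *: p) = 1 by rewrite lead_coefZ mulrC.
have u0 : u != 0 by apply/eqP => u0; move: lead1; rewrite -/u u0 mulr0.
have uq0 : u%:~R != 0 :> rat by rewrite intr_eq0.
have qE : map_poly intr (u *: p) %= q.
  rewrite map_polyZ /= qp; apply: (eqp_trans (eqp_scale _ uq0)).
  by rewrite eqp_sym eqp_scale.
exists (u *: p); split; first by apply/eqP.
- split=> [|d d1]; first by rewrite (eqp_size qE) qirr.1.
  by rewrite (eqp_dvdr _ qE) => /(qirr.2 _ d1) dq; rewrite (eqp_trans dq) // eqp_sym.
- rewrite -intrE; move: qE; rewrite -(eqp_map (ratr : {rmorphism rat -> F})).
  by move/eqp_root => ->.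
Qed.

Lemma seq_norm_bound (F : numDomainType) (T : eqType) (s : seq T) (f : T -> F) :
  exists2 M, 0 <= M & forall x, x \in s -> `|f x| <= M.
Proof.
elim: s => [|a s [M M0 fM]]; first by exists 0.
exists (`|f a| + M) => [|x]; first exact: addr_ge0.
by rewrite inE => /predU1P[->|/fM xM]; rewrite ?lerDl ?ler_wpDl.
Qed.

(** Values at sufficiently many points control the coefficients.  This is
    Newton interpolation: subtract the value at the first point a, divide by
    X - a, and the quotient is again bounded at the remaining points. *)
Lemma interpolation_bound (F : numFieldType) (rs : seq F) (M : F) :
  uniq rs -> 0 <= M ->
  exists2 B : F, 0 <= B & forall r : {poly F}, (size r <= size rs)%N ->
    (forall x, x \in rs -> `|r.[x]| <= M) -> forall i, `|r`_i| <= B.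
Proof.
elim: rs M => [|a rs IH] M /=.
  move=> _ M0; exists 0 => // r; rewrite leqn0 size_poly_eq0 => /eqP -> _ i.
  by rewrite coef0 normr0.
move=> /andP[ars urs] M0.
have [D D0 aD] := seq_norm_bound rs (fun x => (x - a)^-1).
have [|B B0 gB] := IH ((M + M) * D) urs; first by rewrite mulr_ge0 ?addr_ge0.
exists (B + B * `|a| + M) => [|r sr rM i]; first by rewrite !addr_ge0 ?mulr_ge0.
have /factor_theorem[g rg] : root (r - r.[a]%:P) a.
  by rewrite /root hornerD hornerN hornerC subrr.
have rE : r = g * ('X - a%:P) + r.[a]%:P by rewrite -rg subrK.
have sg : (size g <= size rs)%N.
  have [->|g0] := eqVneq g 0; first by rewrite size_poly0.
  have : (size (g * ('X - a%:P))%R <= (size rs).+1)%N.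
    rewrite -rg (leq_trans (size_polyD _ _)) // geq_max sr size_polyN.
    by rewrite (leq_trans (size_polyC_leq1 _)).
  by rewrite size_Mmonic ?monicXsubC // size_XsubC addn2.
have gM x : x \in rs -> `|g.[x]| <= (M + M) * D.
  move=> xrs; have xa : x - a != 0.
    by rewrite subr_eq0; apply: contraNneq ars => <-.
  have -> : g.[x] = (r.[x] - r.[a]) * (x - a)^-1.
    have -> : r.[x] = g.[x] * (x - a) + r.[a].
      by rewrite {1}rE hornerD hornerC hornerM hornerXsubC.
    by rewrite addrK mulfK.
  rewrite normrM ler_pM ?aD //.
  by rewrite (le_trans (ler_normB _ _)) // lerD ?rM // inE ?eqxx ?xrs ?orbT.
have giB := gB g sg gM.
rewrite rE coefD mulrBr coefB coefMX coefMC coefC.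
rewrite (le_trans (ler_normD _ _)) // lerD //; last first.
  by case: ifP => _; rewrite ?normr0 // rM // inE eqxx.
rewrite (le_trans (ler_normB _ _)) // normrM lerD ?ler_wpM2r //.
by case: ifP => _; rewrite ?normr0.
Qed.

Section BoundedConjugates.
Variable R : realType.
Local Notation evalz := (fun (r : {poly int}) (x : R[i]) => (map_poly intr r).[x]).

(** An element r(x) of Z[x] may be written with deg r < deg p.  When the values
    of r at all roots of p are bounded, so are its integer coefficients, which
    leaves finitely many r. *)
Lemma finite_bounded_conjugates (p : {poly int}) (rs : seq R[i]) (M x : R[i]) :
  p \is monic -> map_poly intr p = \prod_(y <- rs) ('X - y%:P) -> uniq rs ->
  0 <= M -> x \in rs ->
  exists s : seq R[i], forall r : {poly int},
    (forall y, y \in rs -> `|evalz r y| <= M) -> evalz r x \in s.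
Proof.
move=> pmon prs urs M0 xrs.
have [B B0 BP] := interpolation_bound urs M0.
have [K KB] : exists K : nat, B <= K%:R.
  have /complex_realP[b bB] := ger0_real B0.
  exists (Num.bound b); rewrite bB -(rmorph_nat (real_complex R)) lecR ltW //.
  by rewrite archi_boundP // -ler0c -bB.
have sp : size p = (size rs).+1.
  rewrite -(@size_map_inj_poly _ _ (intr : int -> R[i])) //; last exact: intr_inj.
  by rewrite prs size_prod_XsubC.
pose val_ (f : {ffun 'I_(size rs) -> 'I_(K + K).+1}) : R[i] :=
  \sum_(i < size rs) ((f i)%:Z - K%:Z)%:~R * x ^+ i.
exists [seq val_ f | f : {ffun 'I_(size rs) -> 'I_(K + K).+1}] => r rM.
pose r' := Pdiv.CommonRing.rmodp r p.
have r'y y : y \in rs -> evalz r' y = evalz r y.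
  move=> yrs; rewrite [in RHS](Pdiv.RingMonic.rdivp_eq pmon r) rmorphD rmorphM.
  rewrite /= hornerD hornerM prs.
  suff /eqP -> : root (\prod_(y <- rs) ('X - y%:P)) y by rewrite mulr0 add0r.
  by rewrite root_prod_XsubC.
have sr' : (size r' <= size rs)%N.
  by rewrite -ltnS -sp Pdiv.CommonRing.ltn_rmodpN0 // monic_neq0.
have r'K i : - K%:Z <= r'`_i <= K%:Z.
  rewrite -ler_norml.
  have : `|(map_poly intr r')`_i : R[i]| <= B.
    apply: BP => [|y yrs]; first exact: leq_trans (size_poly _ _) sr'.
    by rewrite r'y // rM.
  rewrite coef_map /= -intr_norm => /le_trans/(_ KB).
  by rewrite -[K%:R]/(K%:Z%:~R) ler_int.
(* An integer z in [-K, K] is coded by z + K, which lies in [0, 2 K]. *)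
have absK (z : int) : - K%:Z <= z <= K%:Z ->
    (absz (z + K%:Z))%:Z - K%:Z = z /\ (absz (z + K%:Z)%R < (K + K).+1)%N.
  by move=> /andP[? ?]; split; lia.
rewrite -r'y // (@horner_coef_wide _ (size rs)); last first.
  exact: leq_trans (size_poly _ _) sr'.
apply/mapP.
exists [ffun i : 'I_(size rs) => inord (absz (r'`_i + K%:Z)) : 'I_(K + K).+1].
  by rewrite mem_enum.
apply: eq_bigr => i _; rewrite coef_map ffunE inordK.
  by rewrite (absK _ (r'K i)).1.
exact: (absK _ (r'K i)).2.
Qed.

Lemma common_denominator (x : R[i]) (E : seq R[i]) :
  (forall e, e \in E -> exists q : {poly rat}, e = (map_poly ratr q).[x]) ->
  exists2 N : int, N != 0 &
    forall e, e \in E -> exists r : {poly int}, e * N%:~R = evalz r x.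
Proof.
elim: E => [|a E IH] EP; first by exists 1.
have [|N N0 NP] := IH; first by move=> e eE; apply: EP; rewrite inE eE orbT.
have [q ->] := EP a (mem_head _ _).
have [r [d d0 ->]] := rat_poly_scale q.
exists (N * d) => [|e]; first by rewrite mulf_neq0.
rewrite inE => /predU1P[->|/NP[r' er]].
  exists (N *: r); rewrite !map_polyZ /= !hornerZ rmorphV ?unitfE ?intr_eq0 //.
  rewrite !rmorph_int -map_poly_comp (eq_map_poly (g := intr)) => [|z /=].
    by rewrite intrM; field; rewrite intr_eq0.
  by rewrite rmorph_int.
exists (d *: r'); rewrite map_polyZ hornerZ /= -er intrM; ring.
Qed.

(** The arithmetic heart: under c |-> beta c - e with e in a finite subset of
    Q(beta), the real value may grow, so it is kept below C by hypothesis, while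
    each other conjugate y of beta satisfies |y| < 1 and the conjugate of c at y
    never leaves a suitable disc. *)
Lemma pisot_finite_orbits (beta : R) (E : seq R[i]) (C : R[i]) :
  pisot beta -> 0 <= C ->
  (forall e, e \in E -> exists q : {poly rat}, e = (map_poly ratr q).[beta%:C]) ->
  exists Lam : seq R[i], (forall e, e \in E -> `|e| <= C -> e \in Lam) /\
    forall c e, c \in Lam -> e \in E -> `|beta%:C * c - e| <= C ->
      beta%:C * c - e \in Lam.
Proof.
move=> [b1 bint bconj] C0 EQ; set b := beta%:C.
have bintC : integralOver (intr : int -> R[i]) b.
  have [P Pm Pb] := bint; exists P => //.
  have -> : map_poly intr P = map_poly (real_complex R) (map_poly intr P).
    rewrite -map_poly_comp; apply: eq_map_poly => z /=.
    by rewrite rmorph_int.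
  by rewrite fmorph_root.
have [p [pm pirr pb]] := exists_irreducible_poly_int bintC.
have mapE : map_poly ratr (map_poly intr p : {poly rat}) = map_poly intr p :> {poly R[i]}.
  rewrite -map_poly_comp; apply: eq_map_poly => z /=; exact: rmorph_int.
have [rs] := closed_field_poly_normal (map_poly intr p : {poly R[i]}).
have pmC : map_poly intr p \is @monic R[i] by exact: monic_map.
rewrite (monicP pmC) scale1r => prs.
have urs : uniq rs.
  rewrite -separable_prod_XsubC -prs -mapE separable_map separable_poly.unlock.
  rewrite irreducible_poly_coprime //.
  have p0 := irredp_neq0 pirr.
  apply: contraL (lt_size_deriv p0) => /dvdp_leq le; rewrite -leqNgt le //.
  by rewrite -size_poly_gt0 polyorder.size_deriv; case: (size _) pirr.1 => [|[]].
have rsP y : (y \in rs) = root (map_poly intr p) y.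
  by rewrite prs root_prod_XsubC.
have brs : b \in rs by rewrite rsP.
have conj1 y : y \in rs -> y != b -> `|y| < 1.
  rewrite rsP => py yb; apply: bconj => //.
  by exists (map_poly intr p); rewrite mapE monic_map.
have [N N0 NE] := common_denominator EQ.
have NC0 : N%:~R != 0 :> R[i] by rewrite intr_eq0.
have /choice[r_ r_P] : forall e, exists r, e \in E -> e * N%:~R = evalz r b.
  move=> e; case eE: (e \in E); last by exists 0.
  by have [r er] := NE _ eE; exists r.
(* |c| <= M is preserved by c |-> y c - e as soon as |e| <= M (1 - |y|). *)
have [M M0 MP] := seq_norm_bound [seq (e, y) | e <- E, y <- rs]
  (fun z => evalz (r_ z.1) z.2 / (1 - `|z.2|)).
have {}MP e y : e \in E -> y \in rs -> y != b ->
    `|evalz (r_ e) y| <= M * (1 - `|y|).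
  move=> eE yrs yb; have y1 : 0 < 1 - `|y| by rewrite subr_gt0 conj1.
  rewrite -ler_pdivrMr // -[in leLHS](gtr0_norm y1) -normf_div.
  exact: (MP (e, y)) (allpairs_f _ eE yrs).
have [s sP] := @finite_bounded_conjugates p rs (M + C * `|N%:~R|) b pm prs urs
  (addr_ge0 M0 (mulr_ge0 C0 (normr_ge0 _))) brs.
(* In [good], r(y) / N plays the role of the conjugate of c at y. *)
pose good c := `|c| <= C /\ exists2 r : {poly int}, c * N%:~R = evalz r b &
  forall y, y \in rs -> y != b -> `|evalz r y| <= M.
pose Lam := [seq c <- [seq z / N%:~R | z <- s] | `[< good c >]].
have LamP c : c \in Lam <-> good c.
  rewrite mem_filter; split=> [/andP[/asboolP]//|gc].
  apply/andP; split; first exact/asboolP.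
  case: gc => cC [r cr rM].
  apply/mapP; exists (evalz r b); last by rewrite -cr mulfK.
  apply: sP => y yrs; have [->|yb] := eqVneq y b.
    by rewrite -cr normrM ler_wpDl // ler_wpM2r.
  by rewrite ler_wpDr ?rM // mulr_ge0.
exists Lam; split=> [e eE eC|c e /LamP[cC [r cr rM]] eE ceC]; apply/LamP; split=> //.
  exists (r_ e) => [|y yrs yb]; first exact: r_P.
  by rewrite (le_trans (MP _ _ eE yrs yb)) // ler_piMr // gerBl.
exists ('X * r - r_ e) => [|y yrs yb].
  rewrite rmorphB rmorphM /= map_polyX hornerD hornerN hornerM hornerX.
  by rewrite -cr -r_P // mulrBl mulrA.
rewrite rmorphB rmorphM /= map_polyX hornerD hornerN hornerM hornerX.
rewrite (le_trans (ler_normB _ _)) // normrM.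
have -> : M = `|y| * M + M * (1 - `|y|) by ring.
by rewrite lerD ?MP // ler_wpM2l // rM.
Qed.

End BoundedConjugates.

(** * The field generated by beta and zeta *)

Section QuadraticExtension.
Variable R : realType.

Lemma nonreal_Im (z : R[i]) : z \isn't Num.real -> complex.Im z != 0.
Proof. by case: z => a b; rewrite complex_real. Qed.

(** A nonreal root of unity of order 3, 4 or 6 is a root of X^2 - t X + 1 with
    t in {-1, 0, 1}: apart from X - 1 and X + 1, these polynomials are the
    irreducible factors of X^3 - 1, X^4 - 1 and X^6 - 1. *)
Lemma unity_root_trace (zeta : R[i]) : zeta \isn't Num.real ->
  [\/ 3.-unity_root zeta, 4.-unity_root zeta | 6.-unity_root zeta] ->
  [/\ zeta ^+ 12 = 1, zeta * zeta^*%C = 1 &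
      exists t : int, zeta + zeta^*%C = t%:~R].
Proof.
move=> nr h.
have z12 : zeta ^+ 12 = 1.
  case: h => /unity_rootP h.
  - by rewrite -[12%N]/(3 * 4)%N exprM h expr1n.
  - by rewrite -[12%N]/(4 * 3)%N exprM h expr1n.
  - by rewrite -[12%N]/(6 * 2)%N exprM h expr1n.
have z1 : zeta - 1 != 0.
  by apply: contraNneq nr => /subr0_eq ->; rewrite real1.
have zN1 : zeta + 1 != 0.
  by apply: contraNneq nr => /eqP; rewrite addr_eq0 => /eqP ->; rewrite realN real1.
have [t quad] : exists t : int, zeta ^+ 2 + 1 = t%:~R * zeta.
  have [h3|] := eqVneq (zeta ^+ 2 + zeta + 1) 0.
    by exists (-1); apply/eqP; rewrite -subr_eq0 -h3; apply/eqP; ring.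
  have [h6|] := eqVneq (zeta ^+ 2 - zeta + 1) 0.
    by exists 1; apply/eqP; rewrite -subr_eq0 -h6; apply/eqP; ring.
  have [h4|] := eqVneq (zeta ^+ 2 + 1) 0.
    by exists 0; rewrite h4 mul0r.
  move=> h4 h6 h3.
  have : (zeta - 1) * (zeta + 1) * (zeta ^+ 2 + 1) * (zeta ^+ 2 + zeta + 1) *
     (zeta ^+ 2 - zeta + 1) == 0.
    have -> : (zeta - 1) * (zeta + 1) * (zeta ^+ 2 + 1) * (zeta ^+ 2 + zeta + 1) *
     (zeta ^+ 2 - zeta + 1) = (zeta ^+ 6 - 1) * (zeta ^+ 2 + 1) by ring.
    rewrite mulf_eq0; case: h => /unity_rootP h.
    - by rewrite -[6%N]/(3 * 2)%N exprM h expr1n subrr eqxx.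
    - apply/orP; right; move/eqP: h; rewrite -subr_eq0.
      have -> : zeta ^+ 4 - 1 = (zeta - 1) * (zeta + 1) * (zeta ^+ 2 + 1) by ring.
      by rewrite !mulf_eq0 (negbTE z1) (negbTE zN1).
    - by rewrite h subrr eqxx.
  by rewrite !mulf_eq0 (negbTE z1) (negbTE zN1) (negbTE h4) (negbTE h6) (negbTE h3).
suff [] : zeta * zeta^*%C = 1 /\ exists t : int, zeta + zeta^*%C = t%:~R by split.
have := nonreal_Im nr; move: quad; clear.
case: zeta => a b; rewrite -(rmorph_int (real_complex R)) /=.
rewrite expr2; simpc => -[e1 e2] /= b0.
have ta : t%:~R = 2 * a.
  by apply: (mulIf b0); rewrite -e2; ring.
have ab : a * a + b * b = 1 by move: e1; rewrite ta => e1; lra.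
split; last first.
  exists t; rewrite -(rmorph_int (real_complex R)) ta.
  by apply/eqP; rewrite eq_complex /=; apply/andP; split; apply/eqP; lra.
by apply/eqP; rewrite eq_complex /=; apply/andP; split; apply/eqP; lra.
Qed.

Definition rat_poly_values (x : R) : {pred R} :=
  fun y => `[< exists q : {poly rat}, y = (map_poly ratr q).[x] >].

(** For an algebraic x the ring Q[x] is a field: a polynomial not vanishing at x
    is coprime to the minimal polynomial, and a Bezout relation gives the
    inverse. *)
Lemma rat_poly_values_divring (x : R) :
  integralOver (intr : int -> R) x -> GRing.divring_closed (rat_poly_values x).
Proof.
move=> xint; have [p [[p1 pirr] px pdvd]] := exists_irreducible_poly_rat xint.
have mulP y z : y \in rat_poly_values x -> z \in rat_poly_values x ->
    y * z \in rat_poly_values x.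
  move=> /asboolP[q ->] /asboolP[r ->]; apply/asboolP; exists (q * r).
  by rewrite rmorphM hornerM.
split=> [|y z|y z].
- by apply/asboolP; exists 1; rewrite rmorph1 hornerC.
- move=> /asboolP[q ->] /asboolP[r ->]; apply/asboolP; exists (q - r).
  by rewrite rmorphB hornerD hornerN.
- move=> yQ zQ; apply: mulP => //.
  have [->|z0] := eqVneq z 0.
    by apply/asboolP; exists 0; rewrite invr0 rmorph0 horner0.
  move/asboolP: zQ => [q zq].
  have : coprimep p q.
    rewrite irreducible_poly_coprime //; apply: contra z0 => /dvdpP[r qr].
    by rewrite zq qr rmorphM hornerM (eqP px) mulr0.
  case/Bezout_eq1_coprimepP=> -[u v] /= uv; apply/asboolP; exists v.
  apply: (mulIf z0); rewrite mulVf // {1}zq -hornerM -rmorphM.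
  move/(congr1 (fun f : {poly rat} => (map_poly ratr f : {poly R}).[x])): uv.
  by rewrite rmorphD [X in X + _]rmorphM rmorph1 hornerD hornerM (eqP px) mulr0 add0r hornerC.
Qed.

Section Extension.
Variables (Q : {pred R}) (zeta : R[i]).
Hypothesis Qdiv : GRing.divring_closed Q.
Hypothesis zeta_unit : zeta * zeta^*%C = 1.
Hypothesis zeta_trace : exists t : int, zeta + zeta^*%C = t%:~R.

Definition quad_ext : {pred R[i]} :=
  fun z => `[< exists a b, [/\ a \in Q, b \in Q & z = a%:C + b%:C * zeta] >].

Let Q1 : 1 \in Q. Proof. by case: Qdiv. Qed.
Let QB a b : a \in Q -> b \in Q -> a - b \in Q.
Proof. by case: Qdiv => _ h _; exact: h. Qed.
Let Q0 : 0 \in Q. Proof. by rewrite -(subrr 1) QB. Qed.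
Let QD a b : a \in Q -> b \in Q -> a + b \in Q.
Proof. by move=> aQ bQ; rewrite -[b]opprK QB // -(sub0r b) QB. Qed.
Let QV a : a \in Q -> a^-1 \in Q.
Proof. by case: Qdiv => _ _ h aQ; rewrite -(mul1r a^-1) h. Qed.
Let QM a b : a \in Q -> b \in Q -> a * b \in Q.
Proof. by move=> aQ /QV bQ; case: Qdiv => _ _ h; rewrite -[b]invrK h. Qed.
Let Qint (t : int) : t%:~R \in Q.
Proof.
have Qnat (n : nat) : n%:R \in Q by elim: n => // n ih; rewrite mulrSr QD.
by case: t => n; [exact: Qnat | rewrite NegzE rmorphN /= -sub0r QB // Qnat].
Qed.

Lemma quad_ext_real a : a \in Q -> a%:C \in quad_ext.
Proof. by move=> aQ; apply/asboolP; exists a, 0; rewrite mul0r addr0. Qed.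

Lemma quad_ext_gen : zeta \in quad_ext.
Proof. by apply/asboolP; exists 0, 1; rewrite mul1r add0r. Qed.

Lemma quad_extB u v : u \in quad_ext -> v \in quad_ext -> u - v \in quad_ext.
Proof.
move=> /asboolP[a [b [aQ bQ ->]]] /asboolP[c [d [cQ dQ ->]]].
apply/asboolP; exists (a - c), (b - d); split; rewrite ?QB // !rmorphB; ring.
Qed.

Lemma quad_extM u v : u \in quad_ext -> v \in quad_ext -> u * v \in quad_ext.
Proof.
move=> /asboolP[a [b [aQ bQ ->]]] /asboolP[c [d [cQ dQ ->]]].
have [t tE] := zeta_trace.
apply/asboolP; exists (a * c - b * d), (a * d + b * c + t%:~R * (b * d)).
split; rewrite ?QB ?QD ?QM ?Qint // !(rmorphD, rmorphN, rmorphM) rmorph_int /=.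
have zz : zeta ^+ 2 = t%:~R * zeta - 1 by rewrite -tE -zeta_unit; ring.
transitivity (a%:C * c%:C + (a%:C * d%:C + b%:C * c%:C) * zeta
   + b%:C * d%:C * zeta ^+ 2); first by ring.
by rewrite zz; ring.
Qed.

Lemma quad_ext_conj u : u \in quad_ext -> u^*%C \in quad_ext.
Proof.
move=> /asboolP[a [b [aQ bQ ->]]]; have [t tE] := zeta_trace.
have cE : (a%:C + b%:C * zeta)^*%C = a%:C + b%:C * zeta^*%C.
  by case: (zeta) => c d; apply/eqP; rewrite eq_complex /=; apply/andP; split; apply/eqP; ring.
rewrite cE -[zeta^*%C](addKr zeta) tE.
apply/asboolP; exists (a + t%:~R * b), (0 - b).
split; rewrite ?QB ?QD ?QM ?Qint // !(rmorphB, rmorphD, rmorphN, rmorphM) rmorph_int /=.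
by rewrite rmorph0; ring.
Qed.

(** The coordinate of z along zeta in the real basis (1, zeta) of the complex
    plane.  Unlike the imaginary part, it sends Q + Q zeta to Q. *)
Definition zeta_coord (z : R[i]) : R := complex.Im z / complex.Im zeta.

Hypothesis zeta_im : complex.Im zeta != 0.

Lemma zeta_coordE a b : zeta_coord (a%:C + b%:C * zeta) = b.
Proof.
rewrite /zeta_coord; case: zeta zeta_im => c d /= d0.
by rewrite mul0r addr0 add0r mulfK.
Qed.

Lemma quad_ext_coord z : z \in quad_ext -> zeta_coord z \in Q.
Proof. by move=> /asboolP[a [b [_ bQ ->]]]; rewrite zeta_coordE. Qed.

Lemma quad_ext_of_real a : a%:C \in quad_ext -> a \in Q.
Proof.
move=> /asboolP[b [c [bQ cQ e]]]; have := congr1 zeta_coord e.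
rewrite zeta_coordE /zeta_coord /= mul0r => c0.
by move: e; rewrite -c0 mul0r addr0 => -[->].
Qed.

(** The product of u and its conjugate lies in Q + Q zeta and is real, hence
    lies in Q; the conjugate divided by it is the inverse of u. *)
Lemma quad_extV u : u \in quad_ext -> u^-1 \in quad_ext.
Proof.
move=> uE; have [->|u0] := eqVneq u 0.
  by rewrite invr0; exact: quad_ext_real.
have [n nE] : exists n : R, u * u^*%C = n%:C.
  by apply/complex_realP/ger0_real; rewrite mulcJ_ge0.
have nQ : n \in Q.
  apply: quad_ext_of_real; have := quad_extM uE (quad_ext_conj uE).
  by rewrite nE.
have -> : u^-1 = (n^-1)%:C * u^*%C.
  have nV : (n^-1)%:C = (n%:C)^-1 by exact: fmorphV.
  by rewrite nV -nE invfM mulfVK ?conjc_eq0.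
by rewrite quad_extM ?quad_ext_conj // quad_ext_real // QV.
Qed.

Lemma quad_ext_field_generated x :
  x \in Q -> field_generated [set zeta; x%:C] `<=` [set` quad_ext].
Proof.
move=> xQ z; apply => [|_ [->|->]]; [|exact: quad_ext_gen|exact: quad_ext_real].
split; [exact: quad_ext_real | exact: quad_extB |].
by move=> u v uE vE; rewrite quad_extM // quad_extV.
Qed.

End Extension.
End QuadraticExtension.

(** * Coordinates in the parallelogram *)

Section ZetaCoord.
Variables (R : realType) (zeta : R[i]).
Local Notation phi := (zeta_coord zeta).

Lemma zeta_coordD u v : phi (u + v) = phi u + phi v.
Proof. by rewrite /zeta_coord -mulrDl; case: u v => [a b] [c d]. Qed.

Lemma zeta_coordN u : phi (- u) = - phi u.
Proof. by rewrite /zeta_coord -mulNr; case: u => [a b]. Qed.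

Lemma zeta_coordB u v : phi (u - v) = phi u - phi v.
Proof. by rewrite zeta_coordD zeta_coordN. Qed.

Lemma zeta_coordZ (a : R) u : phi (a%:C * u) = a * phi u.
Proof. by rewrite /zeta_coord mulrA; case: u => [b c] /=; rewrite mul0r addr0. Qed.

Lemma zeta_coord_conj_real u : phi (u * u^*%C) = 0.
Proof.
by rewrite /zeta_coord; case: u => [b c] /=; rewrite mulrN [c * b]mulrC addNr mul0r.
Qed.
End ZetaCoord.

Section Parallelogram.
Variables (R : realType) (zeta xi eta1 eta2 : R[i]).
Hypothesis zeta_im : complex.Im zeta != 0.
Hypothesis eta_indep : eta1 / eta2 \isn't Num.real.
Local Notation phi := (zeta_coord zeta).

Lemma eta_det_neq0 : phi (eta2^*%C * eta1) != 0 /\ phi (eta1^*%C * eta2) != 0.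
Proof.
have h : complex.Im (eta2^*%C * eta1) != 0.
  apply: contra eta_indep => /eqP im0.
  have [->|e20] := eqVneq eta2 0; first by rewrite invr0 mulr0 real0.
  have -> : eta1 / eta2 = (eta2^*%C * eta1) / (eta2 * eta2^*%C).
    by field; rewrite ?conjc_eq0 e20.
  rewrite rpredM ?rpredV //; last by rewrite ger0_real ?mulcJ_ge0.
  by case: (_ * _) im0 => a b /= ->; rewrite complex_real.
split; first by rewrite mulf_neq0 ?invr_neq0.
rewrite mulf_neq0 ?invr_neq0 //; apply: contra h => /eqP h; apply/eqP.
by case: eta1 eta2 h => [a b] [c d] /=; lra.
Qed.

(** With [dual2], the dual basis of (eta1, eta2) for the pairing
    (u, z) |-> phi (u z): multiplying by the conjugate of eta2 kills the
    direction eta2. *)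
Definition dual1 := eta2^*%C / (phi (eta2^*%C * eta1))%:C.
Definition dual2 := eta1^*%C / (phi (eta1^*%C * eta2))%:C.

Lemma phi_dual1 z : phi (dual1 * z) = phi (eta2^*%C * z) / phi (eta2^*%C * eta1).
Proof.
have V : ((phi (eta2^*%C * eta1))^-1)%:C = ((phi (eta2^*%C * eta1))%:C)^-1 by exact: fmorphV.
by rewrite /dual1 -V mulrAC mulrC zeta_coordZ mulrC.
Qed.

Lemma phi_dual2 z : phi (dual2 * z) = phi (eta1^*%C * z) / phi (eta1^*%C * eta2).
Proof.
have V : ((phi (eta1^*%C * eta2))^-1)%:C = ((phi (eta1^*%C * eta2))%:C)^-1 by exact: fmorphV.
by rewrite /dual2 -V mulrAC mulrC zeta_coordZ mulrC.
Qed.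

Lemma dual_values : [/\ phi (dual1 * eta1) = 1, phi (dual1 * eta2) = 0,
  phi (dual2 * eta1) = 0 & phi (dual2 * eta2) = 1].
Proof.
have [d1 d2] := eta_det_neq0; rewrite !phi_dual1 !phi_dual2 !divff //.
by split=> //; rewrite [X in zeta_coord _ X]mulrC zeta_coord_conj_real mul0r.
Qed.

Lemma dual_decomp z :
  z = (phi (dual1 * z))%:C * eta1 + (phi (dual2 * z))%:C * eta2.
Proof.
have [] := eta_det_neq0; rewrite !phi_dual1 !phi_dual2 /zeta_coord.
move: zeta_im; move: (complex.Im zeta) => s.
case: z eta1 eta2 => [e f] [a b] [c d] /= s0 d1 d2.
have {}d1 : c * b - d * a != 0.
  by apply: contraNneq d1 => h; rewrite -[X in X / s]/(c * b + - d * a) mulNr h mul0r.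
have {}d2 : a * d - b * c != 0.
  by apply: contraNneq d2 => h; rewrite -[X in X / s]/(a * d + - b * c) mulNr h mul0r.
apply/eqP; rewrite eq_complex /=; apply/andP; split; apply/eqP; field;
  by rewrite s0 !mulNr d1 d2.
Qed.

Definition xcoord z := phi (dual1 * (z - xi)).
Definition ycoord z := phi (dual2 * (z - xi)).

Lemma coord_decomp z : z = xi + (xcoord z)%:C * eta1 + (ycoord z)%:C * eta2.
Proof. by rewrite -addrA -dual_decomp addrC subrK. Qed.

Lemma xcoord_shift z (a b : R) :
  xcoord (z + (a%:C * eta1 + b%:C * eta2)) = xcoord z + a.
Proof.
have [h1 h2 _ _] := dual_values.
rewrite /xcoord addrAC mulrDr zeta_coordD; congr (_ + _); rewrite mulrDr zeta_coordD.
by rewrite !(mulrCA dual1) !zeta_coordZ h1 h2 mulr1 mulr0 addr0.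
Qed.

Lemma ycoord_shift z (a b : R) :
  ycoord (z + (a%:C * eta1 + b%:C * eta2)) = ycoord z + b.
Proof.
have [_ _ h1 h2] := dual_values.
rewrite /ycoord addrAC mulrDr zeta_coordD; congr (_ + _); rewrite mulrDr zeta_coordD.
by rewrite !(mulrCA dual2) !zeta_coordZ h1 h2 mulr1 mulr0 add0r.
Qed.

Local Notation X := (fundamental_domain xi eta1 eta2).

Lemma fundamental_domainE z :
  X z <-> 0 <= xcoord z < 1 /\ 0 <= ycoord z < 1.
Proof.
split=> [[a [b [ha hb ->]]]|[hx hy]]; last first.
  by exists (xcoord z), (ycoord z); split=> //; exact: coord_decomp.
rewrite -addrA xcoord_shift ycoord_shift.
by rewrite /xcoord /ycoord subrr !mulr0 /zeta_coord mul0r !add0r.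
Qed.

Definition open_domain : set R[i] :=
  [set z | 0 < xcoord z < 1 /\ 0 < ycoord z < 1].

Lemma open_domain_sub z : open_domain z -> X z.
Proof.
move=> [/andP[x0 x1] /andP[y0 y1]]; apply/fundamental_domainE.
by rewrite !ltW.
Qed.

Definition linear_bound (u : R[i]) : R :=
  `|phi (u * xi)| + `|phi (u * eta1)| + `|phi (u * eta2)|.

Lemma le_linear_bound u z : X z -> `|phi (u * z)| <= linear_bound u.
Proof.
move=> /fundamental_domainE[/andP[x0 x1] /andP[y0 y1]].
rewrite (coord_decomp z) !mulrDr !zeta_coordD !(mulrCA u) !zeta_coordZ.
rewrite (le_trans (ler_normD _ _)) // lerD // ?(le_trans (ler_normD _ _)) // ?lerD //.
  by rewrite normrM ger0_norm // ler_piMl // ltW.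
by rewrite normrM ger0_norm // ler_piMl // ltW.
Qed.

End Parallelogram.

(** * Polygons cut out by half-planes *)

Section States.
Variables (R : realType) (beta : R) (zeta xi eta1 eta2 : R[i]).
Hypothesis zeta_unit : zeta * zeta^*%C = 1.
Hypothesis zeta_im : complex.Im zeta != 0.
Hypothesis eta_indep : eta1 / eta2 \isn't Num.real.
Hypothesis beta_gt0 : 0 < beta.
Local Notation phi := (zeta_coord zeta).
Local Notation P := (open_domain zeta xi eta1 eta2).
Local Notation dual1 := (dual1 zeta eta1 eta2).
Local Notation dual2 := (dual2 zeta eta1 eta2).

Definition branch (d z : R[i]) := beta%:C * zeta * z - d.

Definition halfplane (h : R[i] * R) : set R[i] := [set z | h.2 < phi (h.1 * z)].

Definition halfplane_next (d : R[i]) (h : R[i] * R) : R[i] * R :=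
  (h.1 * zeta^*%C, beta * h.2 - phi (h.1 * zeta^*%C * d)).

(** As zeta times its conjugate is 1, multiplying the normal by the conjugate of
    zeta undoes the rotation of the branch. *)
Lemma halfplane_branch d h z :
  halfplane (halfplane_next d h) (branch d z) <-> halfplane h z.
Proof.
rewrite /halfplane /= /branch mulrBr zeta_coordB.
have -> : h.1 * zeta^*%C * (beta%:C * zeta * z) = beta%:C * (h.1 * z).
  transitivity (zeta * zeta^*%C * (beta%:C * (h.1 * z))); first by ring.
  by rewrite zeta_unit mul1r.
by rewrite zeta_coordZ ltrD2r ltr_pM2l.
Qed.

Lemma branch_surj d z' : exists z, branch d z = z'.
Proof.
have b0 : beta%:C != 0 by rewrite fmorph_eq0 gt_eqF.
exists ((z' + d) * zeta^*%C / beta%:C); rewrite /branch.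
transitivity (zeta * zeta^*%C * (z' + d) - d); first by field; exact: b0.
by rewrite zeta_unit mul1r addrK.
Qed.

Definition sides : seq (R[i] * R) :=
  [:: (dual1, phi (dual1 * xi)); (- dual1, - phi (dual1 * xi) - 1);
      (dual2, phi (dual2 * xi)); (- dual2, - phi (dual2 * xi) - 1)].

Lemma open_domainE z : P z <-> forall h, h \in sides -> halfplane h z.
Proof.
rewrite /open_domain /= /xcoord /ycoord !mulrBr !zeta_coordB.
split=> [[/andP[x0 x1] /andP[y0 y1]] h|hP].
  by rewrite !inE => /or4P[] /eqP ->; rewrite /halfplane /= ?mulNr ?zeta_coordN; lra.
have m k : (k < 4)%N -> halfplane (nth (0, 0) sides k) z.
  by move=> k4; apply/hP/mem_nth.
move: (m 0%N isT) (m 1%N isT) (m 2%N isT) (m 3%N isT).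
rewrite /halfplane /= !mulNr !zeta_coordN => h0 h1 h2 h3.
by split; apply/andP; split; lra.
Qed.

Variables (U : seq R[i]) (Lam : seq R) (A : set R[i]) (C : R).
Hypothesis U_rot : forall u, u \in U -> u * zeta^*%C \in U.
Hypothesis U_sides : forall h, h \in sides -> h.1 \in U.
Hypothesis Lam_sides : forall h, h \in sides -> h.2 \in Lam.
Hypothesis Lam_next : forall d u c, A d -> u \in U -> c \in Lam ->
  `|beta * c - phi (u * zeta^*%C * d)| <= C ->
  beta * c - phi (u * zeta^*%C * d) \in Lam.
Hypothesis U_bound : forall u z, u \in U -> P z -> `|phi (u * z)| <= C.

(** Names of the half-planes whose boundary may cross the parallelogram; sets of
    such names are the vertices of the graph. *)
Definition crossing : seq (R[i] * R) := [seq (u, c) | u <- U, c <- Lam].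

Definition cell (S : {set seq_sub crossing}) : set R[i] :=
  [set z | P z /\ forall h, h \in S -> halfplane (val h) z].

(** An edge only asks that every point of the target come from the source, so
    that a path can be followed backwards from any point of its last cell. *)
Definition cell_step (S : {set seq_sub crossing}) (d : R[i])
    (S' : {set seq_sub crossing}) : Prop :=
  cell S' !=set0 /\
  forall z', cell S' z' -> exists2 z, cell S z & branch d z = z'.

Definition chain (n : nat) (w : nat -> R[i]) (z : nat -> R[i]) : Prop :=
  (forall i, (i <= n)%N -> P (z i)) /\
  forall i, (i < n)%N -> z i.+1 = branch (w i) (z i).

Lemma chain_of_path n (w : nat -> R[i]) (v : nat -> {set seq_sub crossing}) :
  (0 < n)%N -> (forall i, (i < n)%N -> cell_step (v i) (w i) (v i.+1)) ->
  exists z, chain n w z.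
Proof.
move=> n0 vP.
have back k y : (k <= n)%N -> cell (v k) y -> exists2 z, z k = y & chain k w z.
  elim: k y => [|k IH] y kn yP.
    by exists (fun=> y) => //; split=> // i _; case: yP.
  have [_ /(_ _ yP)[x xP xy]] := vP k kn.
  have [z zk [zP zw]] := IH x (ltnW kn) xP.
  exists (fun i => if (i <= k)%N then z i else y); first by rewrite ltnn.
  split=> i.
    by rewrite leq_eqVlt ltnS => /predU1P[->|ik];
      [rewrite ltnn; case: yP | rewrite ik; exact: zP].
  rewrite ltnS => le; have /predU1P[->|ik] : (i == k) || (i < k)%N.
  - by rewrite -leq_eqVlt.
  - by rewrite ltnn leqnn zk xy.
  - by rewrite ik ltnW // zw.
case: n n0 vP back => // n _ vP back.
have [[y yP] _] := vP n (ltnSn n).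
by have [z _ zC] := back n.+1 y (leqnn _) yP; exists z.
Qed.

(** All half-planes of the finite list that contain the image of the cell S
    inside the parallelogram. *)
Definition next_state (S : {set seq_sub crossing}) (d : R[i]) :
    {set seq_sub crossing} :=
  [set h | `[< forall z, cell S z -> P (branch d z) ->
                 halfplane (val h) (branch d z) >]].

Lemma cell_halfplane S z (h : R[i] * R) :
  cell S z -> (h \in sides \/ exists2 h', h' \in S & h = val h') -> halfplane h z.
Proof. by move=> [/open_domainE zP zS] [/zP//|[h' /zS hz ->]]. Qed.

(** Each constraint defining S has an image under the branch.  Either its
    threshold is at most C in absolute value and it belongs to the finite list,
    or the half-plane does not cross the parallelogram, and then it contains it,
    because it contains the point branch d z.  So the listed half-planes cut out
    the whole image of the cell. *)
Lemma next_state_step S d z :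
  A d -> cell S z -> P (branch d z) ->
  cell (next_state S d) (branch d z) /\ cell_step S d (next_state S d).
Proof.
move=> dA zS zP; have zN : cell (next_state S d) (branch d z).
  by split=> // h; rewrite inE => /asboolP; exact.
split=> //; split=> [|z' [z'P z'S]]; first by exists (branch d z).
have [y yz'] := branch_surj d z'; exists y => //.
suff yS h : (h \in sides \/ exists2 h', h' \in S & h = val h') -> halfplane h y.
  split; first by apply/open_domainE => h hs; apply: yS; left.
  by move=> h hS; apply: yS; right; exists h.
move=> hS; apply/(halfplane_branch d); rewrite yz'.
have [hU hL] : h.1 \in U /\ h.2 \in Lam.
  case: hS => [hs|[h' _ ->]]; first by split; [exact: U_sides|exact: Lam_sides].
  by have /allpairsP[[u c] /= [uU cL ->]] := valP h'.
have nextP y' : cell S y' -> halfplane (halfplane_next d h) (branch d y').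
  by move=> y'S; apply/halfplane_branch; exact: cell_halfplane hS.
have [le|gt] := leP `|(halfplane_next d h).2| C.
  have nC : halfplane_next d h \in crossing.
    by apply/allpairsP; exists (halfplane_next d h);
      split=> //; [exact: U_rot|exact: Lam_next].
  apply: (z'S (SeqSub nC)); rewrite inE; apply/asboolP => y' y'S _.
  exact: nextP.
have := nextP z zS; rewrite /halfplane /= -/(halfplane_next d h).
have := U_bound (U_rot hU) zP; have := U_bound (U_rot hU) z'P.
move: gt; rewrite /= !ler_norml lter_normr.
move=> /orP[] gt /andP[l1 _] /andP[_ l2] l3; last by rewrite (lt_le_trans _ l1) // ltrNr.
by have := lt_trans l3 (le_lt_trans l2 gt); rewrite ltxx.
Qed.

Lemma path_of_chain n (w z : nat -> R[i]) :
  (forall i, (i < n)%N -> A (w i)) -> chain n w z ->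
  exists v : nat -> {set seq_sub crossing},
    forall i, (i < n)%N -> cell_step (v i) (w i) (v i.+1).
Proof.
move=> wA [zP zw].
pose v := fix v i := if i is j.+1 then next_state (v j) (w j) else finset.set0.
have vz i : (i <= n)%N -> cell (v i) (z i).
  elim: i => [|i IH] ni /=; first by split; [exact: zP|move=> h; rewrite inE].
  rewrite zw //.
  by apply: (next_state_step (wA i ni) (IH (ltnW ni)) _).1; rewrite -zw //; exact: zP.
exists v => i ni.
apply: (next_state_step (wA i ni) (vz i (ltnW ni)) _).2.
by rewrite -zw //; exact: zP.
Qed.

End States.

(** * Boundary of the parallelogram *)

Section Topology.
Import numFieldNormedType.Exports.
Variables (R : realType) (zeta xi eta1 eta2 : R[i]).
Hypothesis zeta_im : complex.Im zeta != 0.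
Hypothesis eta_indep : eta1 / eta2 \isn't Num.real.
Local Notation phi := (zeta_coord zeta).
Local Notation P := (open_domain zeta xi eta1 eta2).
Local Notation X := (fundamental_domain xi eta1 eta2).
Local Notation dual1 := (dual1 zeta eta1 eta2).
Local Notation dual2 := (dual2 zeta eta1 eta2).
Local Notation xc := (xcoord zeta xi eta1 eta2).
Local Notation yc := (ycoord zeta xi eta1 eta2).

Lemma zeta_coord_lipschitz (u : R[i]) : exists2 K : R, 0 < K &
  forall z, `|phi (u * z)|%:C <= K%:C * `|z|.
Proof.
have [k uk] : exists k : R, `|u| = k%:C by apply/complex_realP/normr_real.
exists ((k + 1) / `|complex.Im zeta|) => [|z].
  by rewrite divr_gt0 ?normr_gt0 // ltr_wpDl // -ler0c -uk normr_ge0.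
have s0 : 0 < `|complex.Im zeta| by rewrite normr_gt0.
have V : ((k + 1) / `|complex.Im zeta|)%:C = (k + 1)%:C / (`|complex.Im zeta|)%:C.
  by rewrite rmorphM /=; congr (_ * _); exact: fmorphV.
have V' : `|phi (u * z)|%:C = `|complex.Im (u * z)|%:C / (`|complex.Im zeta|)%:C.
  by rewrite /zeta_coord normf_div rmorphM /=; congr (_ * _); exact: fmorphV.
rewrite V V' mulrAC ler_pM2r ?invr_gt0 ?ltcR //.
have h : `|complex.Im (u * z)|%:C <= `|u * z|.
  have := normc_ge_Re (u * z * 'i%C); rewrite ReiNIm normrN normrM => /le_trans; apply.
  suff -> : `|'i%C : R[i]| = 1 by rewrite mulr1.
  by rewrite normc_def /= expr0n expr1n add0r sqrtr1.
rewrite (le_trans h) // normrM uk ler_wpM2r // lecR lerDl //.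
Qed.

Lemma zeta_coord_continuous (u c : R[i]) :
  continuous (fun z : R[i]^o => phi (u * (z - c)) : R).
Proof.
have [K K0 lip] := zeta_coord_lipschitz u.
move=> z; have FF : Filter (nbhs (z : R[i]^o)) by exact: nbhs_filter.
apply/(@cvgrPdist_lt R R^o _ _ FF) => e e0.
have eK : 0 < (e / K)%:C :> R[i] by rewrite ltcR divr_gt0.
apply/nbhs_ballP; exists (e / K)%:C => // y; rewrite /ball /= => zy.
rewrite -ltcR -zeta_coordB -mulrBr opprB addrA subrK (le_lt_trans (lip _)) //.
have KC : 0 < K%:C :> R[i] by rewrite ltcR.
rewrite -(ltr_pM2l KC) in zy; apply: lt_le_trans zy _.
by rewrite -rmorphM /= mulrCA mulfV ?gt_eqF // mulr1.
Qed.

Lemma xcoord_continuous : continuous (xc : R[i]^o -> R).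
Proof. exact: zeta_coord_continuous. Qed.

Lemma ycoord_continuous : continuous (yc : R[i]^o -> R).
Proof. exact: zeta_coord_continuous. Qed.

Definition on_side_line : set R[i] :=
  [set z | [\/ xc z = 0, xc z = 1, yc z = 0 | yc z = 1]].

Lemma open_domain_open : open (P : set R[i]^o).
Proof.
have -> : P = xc @^-1` [set x | 0 < x] `&` xc @^-1` [set x | x < 1]
    `&` (yc @^-1` [set x | 0 < x] `&` yc @^-1` [set x | x < 1]).
  apply/seteqP; split=> z /=; first by move=> [/andP[? ?] /andP[? ?]].
  by move=> [[? ?] [? ?]]; split; apply/andP.
have opreim (f : R[i]^o -> R) : continuous f ->
    open (f @^-1` [set x | 0 < x] `&` f @^-1` [set x | x < 1]).
  move=> fc; apply: openI; apply: open_comp; try by move=> z _; exact: fc.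
    exact: open_gt.
  exact: open_lt.
apply: openI; apply: opreim.
  exact: xcoord_continuous.
exact: ycoord_continuous.
Qed.

Lemma closure_domain_sub : closure (X : set R[i]^o) `<=`
  [set z | 0 <= xc z <= 1 /\ 0 <= yc z <= 1].
Proof.
have -> : [set z | 0 <= xc z <= 1 /\ 0 <= yc z <= 1] =
   xc @^-1` [set x | 0 <= x] `&` xc @^-1` [set x | x <= 1]
    `&` (yc @^-1` [set x | 0 <= x] `&` yc @^-1` [set x | x <= 1]) :> set R[i]^o.
  apply/seteqP; split=> z /=; first by move=> [/andP[? ?] /andP[? ?]].
  by move=> [[? ?] [? ?]]; split; apply/andP.
set Y := _ `&` _.
suff /closure_id -> : closed (Y : set R[i]^o).
  apply: closureS => z /(fundamental_domainE _ zeta_im eta_indep).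
  by move=> [/andP[x0 x1] /andP[y0 y1]]; split; split=> //=; exact: ltW.
have cpreim (f : R[i]^o -> R) : continuous f ->
    closed (f @^-1` [set x | 0 <= x] `&` f @^-1` [set x | x <= 1]).
  move=> fc; apply: closedI; apply: preimage_closed; try by move=> z _; exact: fc.
    exact: closed_ge.
  exact: closed_le.
apply: closedI; apply: cpreim.
  exact: xcoord_continuous.
exact: ycoord_continuous.
Qed.

Lemma domain_boundary_side z : domain_boundary xi eta1 eta2 z -> on_side_line z.
Proof.
move=> [/closure_domain_sub /= [/andP[x0 x1] /andP[y0 y1]] zI].
have nP : ~ P z.
  move=> zP; apply: zI; apply: (filterS _ (open_nbhs_nbhs (conj open_domain_open zP))).
  by move=> y /(open_domain_sub zeta_im eta_indep).
have [x00|xn0] := eqVneq (xc z) 0; first by constructor 1.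
have [x11|xn1] := eqVneq (xc z) 1; first by constructor 2.
have [y00|yn0] := eqVneq (yc z) 0; first by constructor 3.
have [y11|yn1] := eqVneq (yc z) 1; first by constructor 4.
exfalso; apply: nP; split.
  by rewrite !lt_neqAle x0 x1 xn1 eq_sym xn0.
by rewrite !lt_neqAle y0 y1 yn1 eq_sym yn0.
Qed.

(** An interior point can be moved by a small multiple of - eta1 - eta2 without
    leaving the half-open parallelogram, so its coordinates are not 0. *)
Lemma not_boundary_open z : X z -> ~ domain_boundary xi eta1 eta2 z -> P z.
Proof.
move=> zX nb; have zI : interior (X : set R[i]^o) z.
  by apply: contrapT => zI; apply: nb; split=> //; exact: subset_closure.
have /nbhs_ballP[e e0 eX] := zI.
have [r re] : exists r : R, e = r%:C by apply/complex_realP/ger0_real/ltW.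
have [m me] : exists m : R, `|eta1 + eta2| = m%:C by apply/complex_realP/normr_real.
have m0 : 0 <= m by rewrite -ler0c -me normr_ge0.
have r0 : 0 < r by rewrite -ltcR -re.
pose d := r / (m + 1); have d0 : 0 < d by rewrite divr_gt0 // ltr_wpDl.
pose z' := z + ((- d)%:C * eta1 + (- d)%:C * eta2).
have /eX : ball (z : R[i]^o) e z'.
  rewrite /ball /=.
  have -> : z - z' = d%:C * (eta1 + eta2) by rewrite /z' rmorphN; ring.
  have dC : `|d%:C| = d%:C :> R[i] by rewrite ger0_norm // ler0c ltW.
  rewrite normrM me re dC.
  rewrite -rmorphM /= ltcR /d mulrAC ltr_pdivrMr ?ltr_wpDl //.
  by rewrite ltr_pM2l // ltrDl.
move=> /(fundamental_domainE _ zeta_im eta_indep).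
rewrite /z' xcoord_shift // ycoord_shift // => -[/andP[hx _] /andP[hy _]].
have [/andP[_ x1] /andP[_ y1]] := (fundamental_domainE _ zeta_im eta_indep _).1 zX.
by split; apply/andP; split => //; lra.
Qed.
End Topology.

(** * Generic points and admissible words *)

Lemma unit_interval_shift (R : realType) (k : int) (a b : R) :
  0 <= a < 1 -> 0 <= b < 1 -> b = a + k%:~R -> k = 0.
Proof.
move=> ha hb ab; apply/eqP; rewrite -normr_le0 -ltzD1 add0r.
by rewrite -(ltr_int R) intr_norm ltr_norml /=; apply/andP; split; lra.
Qed.

Section Generic.
Import numFieldNormedType.Exports.
Variables (R : realType) (beta : R) (zeta xi eta1 eta2 : R[i]).
Hypothesis zeta_im : complex.Im zeta != 0.
Hypothesis eta_indep : eta1 / eta2 \isn't Num.real.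
Hypothesis beta_gt0 : 0 < beta.
Local Notation phi := (zeta_coord zeta).
Local Notation P := (open_domain zeta xi eta1 eta2).
Local Notation X := (fundamental_domain xi eta1 eta2).
Local Notation dual1 := (dual1 zeta eta1 eta2).
Local Notation dual2 := (dual2 zeta eta1 eta2).
Local Notation xc := (xcoord zeta xi eta1 eta2).
Local Notation yc := (ycoord zeta xi eta1 eta2).
Local Notation lattice := (lattice eta1 eta2).
Local Notation digit := (digit beta zeta xi eta1 eta2).
Local Notation T := (rbeta_map beta zeta xi eta1 eta2).
Local Notation branch := (branch beta zeta).
Local Notation side_line := (on_side_line zeta xi eta1 eta2).

Lemma coord_lattice_shift z (m n : int) :
  xc (z + (m%:~R * eta1 + n%:~R * eta2)) = xc z + m%:~R /\
  yc (z + (m%:~R * eta1 + n%:~R * eta2)) = yc z + n%:~R.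
Proof.
have iE (k : int) : k%:~R = (k%:~R : R)%:C :> R[i] by rewrite rmorph_int.
by rewrite !iE xcoord_shift // ycoord_shift.
Qed.

Lemma lattice_repr_unique z z' : X z -> X z' -> lattice (z' - z) -> z' = z.
Proof.
move=> /(fundamental_domainE _ zeta_im eta_indep)[hx hy].
move=> /(fundamental_domainE _ zeta_im eta_indep)[hx' hy'] [m [n e]].
have {}e : z' = z + (m%:~R * eta1 + n%:~R * eta2) by rewrite -e addrC subrK.
have [ex ey] := coord_lattice_shift z m n; rewrite -e in ex ey.
by rewrite e (unit_interval_shift hx hx' ex) (unit_interval_shift hy hy' ey) !mul0r !addr0.
Qed.

Lemma lattice_reduction z : exists2 l, lattice l & X (z - l).
Proof.
pose m := Num.floor (xc z); pose n := Num.floor (yc z).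
exists (m%:~R * eta1 + n%:~R * eta2); first by exists m, n.
have -> : z - (m%:~R * eta1 + n%:~R * eta2) =
    z + ((- m)%:~R * eta1 + (- n)%:~R * eta2) by rewrite !rmorphN; ring.
apply/(fundamental_domainE _ zeta_im eta_indep).
have [-> ->] := coord_lattice_shift z (- m) (- n).
rewrite !rmorphN /= !subr_ge0 !ltrBlDl.
by have := floor_itv (xc z); have := floor_itv (yc z);
  rewrite -/m -/n !intrD => /andP[-> ->] /andP[-> ->].
Qed.

Lemma digitP z : lattice (digit z) /\ X (T z).
Proof.
by have [l lL lX] := lattice_reduction (beta%:C * zeta * z);
  exact: (@xgetPex _ 0 [set l | lattice l /\ X (beta%:C * zeta * z - l)]
    (ex_intro _ l (conj lL lX))).
Qed.

Lemma digit_branch d z : lattice d -> X (branch d z) -> digit z = d.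
Proof.
move=> dL dX; have [zL zX] := digitP z.
have e : T z = branch d z.
  apply: lattice_repr_unique => //.
  have -> : T z - branch d z = d - digit z by rewrite /rbeta_map /Defs.rbeta_map /branch; ring.
  move: dL zL => [m [n ->]] [m' [n' ->]]; exists (m - m'), (n - n').
  by rewrite !rmorphB; ring.
have : digit z = beta%:C * zeta * z - T z by rewrite /rbeta_map; ring.
by rewrite e => ->; rewrite /branch; ring.
Qed.

Lemma iter_rbeta_map_domain k z : X z -> X (iter k T z).
Proof. by case: k => // k _; rewrite iterS; case: (digitP (iter k T z)). Qed.

Definition lattice_pt (d : int * int) : R[i] := d.1%:~R * eta1 + d.2%:~R * eta2.

(** Composition of branches along a word of lattice points; there are countably
    many of these, which is why points are coded by pairs of integers. *)
Definition branch_word (s : seq (int * int)) (z : R[i]) : R[i] :=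
  foldl (fun y d => branch (lattice_pt d) y) z s.

Lemma branch_word_affine s :
  exists a c, a != 0 /\ forall z, branch_word s z = a * z + c.
Proof.
elim/last_ind: s => [|s d [a [c [a0 ac]]]].
  by exists 1, 0; rewrite oner_neq0; split=> // z; rewrite mul1r addr0.
exists (beta%:C * zeta * a), (beta%:C * zeta * c - lattice_pt d); split.
  rewrite !mulf_neq0 //; first by rewrite fmorph_eq0 gt_eqF.
  by apply: contraNneq zeta_im => ->.
by move=> z; rewrite /branch_word foldl_rcons -/(branch_word s z) ac /branch; ring.
Qed.

Lemma iter_rbeta_map_word k z : exists s, iter k T z = branch_word s z.
Proof.
elim: k => [|k [s sE]]; first by exists [::].
have [[m [n dE]] _] := digitP (iter k T z).
exists (rcons s (m, n)); rewrite /branch_word foldl_rcons -/(branch_word s z) -sE.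
by rewrite iterS /branch /lattice_pt /= -dE.
Qed.

Lemma cvg_int_right0 (f : R -> R) (l : R) :
  (forall e, exists m : int, f e = m%:~R) -> f @ (0 : R)^'+ --> l ->
  exists m : int, l = m%:~R.
Proof.
move=> fint fl.
have near1 : \forall e \near (0:R)^'+, `|l - f e| < 2^-1.
  by move/cvgrPdist_lt : fl; apply; rewrite invr_gt0.
have PF : ProperFilter (at_right (0 : R)) by exact: at_right_proper_filter.
have [e0 e0l] := @filter_ex _ _ PF _ near1.
have [m fm] := fint e0; exists m.
have fm' : \forall e \near (0:R)^'+, m%:~R = f e.
  apply: filterS near1 => e el; have [k fk] := fint e.
  rewrite fk; congr _%:~R; rewrite fk in el; rewrite fm in e0l.
  have h : `|(m - k)%:~R : R| < 1.
    rewrite rmorphB /=; move: el e0l; rewrite !ltr_norml; lra.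
  move: h; rewrite -intr_norm -[1]/(1%:~R) ltr_int; clear; lia.
apply: (cvg_unique (@Rhausdorff R) fl).
by apply: cvg_near_cst; apply: filterS fm' => e ->.
Qed.

(** The limit point is the image of y under one branch: the digits along the
    approach have integer coordinates and converge, so their limit is again a
    lattice point. *)
Lemma side_image_branch a b (S : set R[i]) w :
  side_image beta zeta xi eta1 eta2 a b S w ->
  exists y d, S y /\ w = branch (lattice_pt d) y.
Proof.
move=> [t [_ Sy wlim]]; set y := xi + a + t%:C * b in Sy.
exists y; pose p (e : R) : R[i] := xi + (1 - e)%:C * a + t%:C * b.
have intlim (u : R[i]) : (forall l, lattice l -> exists m : int, phi (u * l) = m%:~R) ->
    exists m : int, phi (u * (beta%:C * zeta * y - w)) = m%:~R.
  move=> uint.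
  pose f e := phi (u * digit (p e)).
  have fE e : f e = phi (u * (beta%:C * zeta * y)) - e * phi (u * (beta%:C * zeta * a))
       - phi (u * (T (p e) - 0)).
    rewrite /f -zeta_coordZ -!zeta_coordB; congr zeta_coord.
    by rewrite /rbeta_map /p /y rmorphB; ring.
  have h : f @ (0 : R)^'+ --> phi (u * (beta%:C * zeta * y)) -
      0 * phi (u * (beta%:C * zeta * a)) - phi (u * (w - 0)).
    rewrite (funext fE); apply: cvgB; last first.
      apply: (cvg_comp (fun e => T (p e) : R[i]^o) (fun z : R[i]^o => phi (u * (z - 0))) wlim).
      exact: zeta_coord_continuous.
    apply: cvgB; first exact: cvg_cst.
    by apply: cvgMl; apply: cvg_within_filter.
  have [|m mE] := cvg_int_right0 _ h; first by move=> e; apply: uint; case: (digitP (p e)).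
  by exists m; rewrite mulrBr zeta_coordB -mE mul0r !subr0.
have [h11 h12 h21 h22] := dual_values zeta_im eta_indep.
have iC (k : int) (u : R[i]) : k%:~R * u = (k%:~R : R)%:C * u by rewrite rmorph_int.
have [m mE] : exists m : int, phi (dual1 * (beta%:C * zeta * y - w)) = m%:~R.
  apply: intlim => _ [i [j ->]]; exists i.
  rewrite !iC mulrDr zeta_coordD !(mulrCA dual1) !zeta_coordZ h11 h12; ring.
have [n nE] : exists m : int, phi (dual2 * (beta%:C * zeta * y - w)) = m%:~R.
  apply: intlim => _ [i [j ->]]; exists j.
  rewrite !iC mulrDr zeta_coordD !(mulrCA dual2) !zeta_coordZ h21 h22; ring.
exists (m, n); split=> //; rewrite /branch /lattice_pt /= !iC -mE -nE.
by rewrite -dual_decomp //; ring.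
Qed.

Lemma iter_rbeta_image_word k S w :
  iter k (rbeta_image beta zeta xi eta1 eta2) S w ->
  exists s y, S y /\ w = branch_word s y.
Proof.
elim: k w => [|k IH] w /=; first by exists [::], w.
have next y d : iter k (rbeta_image beta zeta xi eta1 eta2) S y ->
    exists s x, S x /\ branch (lattice_pt d) y = branch_word s x.
  move=> /IH[s [x [Sx yE]]]; exists (rcons s d), x; split=> //.
  by rewrite /branch_word foldl_rcons -/(branch_word s x) -yE.
move=> [[[y [yS _] <-]|]|].
- have [[m [n dE]] _] := digitP y.
  have [s [x [Sx e]]] := next y (m, n) yS.
  by exists s, x; split=> //; rewrite -e /branch /lattice_pt /= -dE.
- by move=> /side_image_branch[y [d [yS ->]]]; exact: next.
- by move=> /side_image_branch[y [d [yS ->]]]; exact: next.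
Qed.

(** Coordinates (t, t^2) with respect to (eta1, eta2): an arc that contains no
    segment of a line, whatever the direction of the line. *)
Definition parabola (z0 : R[i]) (t : R) : R[i] :=
  z0 + (t%:C * eta1 + (t ^+ 2)%:C * eta2).

Lemma parabola_line_finite (u c z0 : R[i]) (v : R) :
  u != 0 -> finite_set [set t | phi (u * (parabola z0 t - c)) = v].
Proof.
move=> u0; pose b1 := phi (u * eta1); pose b2 := phi (u * eta2).
pose p : {poly R} := (phi (u * (z0 - c)) - v)%:P + b1 *: 'X + b2 *: 'X^2.
have pE t : p.[t] = phi (u * (parabola z0 t - c)) - v.
  rewrite /p !hornerD hornerC !hornerZ hornerX hornerXn /parabola.
  have -> : u * (z0 + (t%:C * eta1 + (t ^+ 2)%:C * eta2) - c) =
     u * (z0 - c) + t%:C * (u * eta1) + (t ^+ 2)%:C * (u * eta2) by ring.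
  by rewrite !zeta_coordD !zeta_coordZ -/b1 -/b2; ring.
have p0 : p != 0.
  apply/eqP => pz.
  have pi i : p`_i = 0 by rewrite pz coef0.
  have b10 : b1 = 0 by have := pi 1%N; rewrite /p !coefE /= !mulr1 mulr0 addr0 add0r.
  have b20 : b2 = 0 by have := pi 2%N; rewrite /p !coefE /= !mulr1 mulr0 !add0r.
  have : phi (u * (u^-1 * zeta)) = 1 by rewrite mulVKf // /zeta_coord divff.
  rewrite (dual_decomp zeta_im eta_indep (u^-1 * zeta)).
  rewrite mulrDr !(mulrCA u) zeta_coordD !zeta_coordZ -/b1 -/b2 b10 b20 !mulr0 addr0.
  by move/eqP; rewrite eq_sym oner_eq0.
suff sub : [set t | phi (u * (parabola z0 t - c)) = v] `<=` [set` polyrcf.rootsR p].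
  exact: sub_finite_set sub (finite_seq _).
move=> t /= tv.
by rewrite -(polyrcf.roots_on_rootsR p0) /= /root pE tv subrr.
Qed.

Lemma parabola_side_finite (a c z0 : R[i]) : a != 0 ->
  finite_set [set t | side_line (a * parabola z0 t + c)].
Proof.
move=> a0.
have dual_neq0 (u w : R[i]) : phi (u * w) = 1 -> u != 0.
  move=> h; apply/eqP => uE; move: h.
  by rewrite uE mul0r /zeta_coord mul0r => /eqP; rewrite eq_sym oner_eq0.
have [h11 _ _ h22] := dual_values zeta_im eta_indep.
have d1 : a * dual1 != 0 by rewrite mulf_neq0 // (dual_neq0 _ _ h11).
have d2 : a * dual2 != 0 by rewrite mulf_neq0 // (dual_neq0 _ _ h22).
have E u t : u * (a * parabola z0 t + c - xi) =
    a * u * (parabola z0 t - a^-1 * (xi - c)) by field.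
apply: sub_finite_set (_ : finite_set (
  ([set t | phi (a * dual1 * (parabola z0 t - a^-1 * (xi - c))) = 0] `|`
   [set t | phi (a * dual1 * (parabola z0 t - a^-1 * (xi - c))) = 1]) `|`
  ([set t | phi (a * dual2 * (parabola z0 t - a^-1 * (xi - c))) = 0] `|`
   [set t | phi (a * dual2 * (parabola z0 t - a^-1 * (xi - c))) = 1]))).
  move=> t; rewrite /on_side_line /xcoord /ycoord /= !E.
  by case; [left; left|left; right|right; left|right; right].
by rewrite !finite_setU; do !split; exact: parabola_line_finite.
Qed.

Local Notation boundary_orbits :=
  (\bigcup_n rbeta_power beta zeta xi eta1 eta2 n (domain_boundary xi eta1 eta2)).

(** A point of the forward image of the boundary is the image of a point of a
    side line under some word; a point of its preimage is sent to a side line by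
    some word. *)
Lemma parabola_boundary_countable z0 :
  countable [set t | boundary_orbits (parabola z0 t)].
Proof.
pose bad1 s := [set t | side_line (branch_word s (parabola z0 t))].
pose bad2 s := [set t | exists2 y, side_line y & branch_word s y = parabola z0 t].
suff : [set t | boundary_orbits (parabola z0 t)] `<=`
    \bigcup_s (bad1 s `|` bad2 s).
  move=> /subset_card_le/sub_countable; apply; apply: bigcup_countable => // s _.
  apply: finite_set_countable; rewrite finite_setU.
  have [a [c [a0 aE]]] := branch_word_affine s.
  have ai0 : a^-1 != 0 by rewrite invr_neq0.
  split; first by apply: sub_finite_set (parabola_side_finite c z0 a0) => t; rewrite /bad1 /= aE.
  apply: sub_finite_set (parabola_side_finite (- (a^-1 * c)) z0 ai0) => t.
  by rewrite /bad2 /= => -[y yS <-]; rewrite aE mulrDr mulKf // addrK.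
move=> t [[k|k] _] /=.
- move=> /iter_rbeta_image_word[s [y [/(domain_boundary_side zeta_im eta_indep) yS yE]]].
  by exists s => //; right; exists y.
- move=> [_ /(domain_boundary_side zeta_im eta_indep)]; rewrite -iterS.
  by have [s ->] := iter_rbeta_map_word k.+1 (parabola z0 t); exists s => //; left.
Qed.

(** A nontrivial interval has positive length, so it is not countable. *)
Lemma exists_generic_parameter z0 (d : R) : 0 < d ->
  exists t : R, 0 < t < d /\ ~ boundary_orbits (parabola z0 t).
Proof.
move=> d0; apply: contrapT => /forallNP no.
have sub : `]0, d[%classic `<=` [set t | boundary_orbits (parabola z0 t)].
  move=> t; rewrite /= in_itv /= => td; apply: contrapT => nt; exact: (no t (conj td nt)).
have := countable_lebesgue_measure0 (sub_countable (subset_card_le sub) (parabola_boundary_countable z0)).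
rewrite lebesgue_measure_itv /= lte_fin d0 sube0 => /eqP.
by rewrite eqe gt_eqF.
Qed.

Lemma halfplane_near (h : R[i] * R) z v1 v2 : halfplane zeta h z ->
  exists2 d : R, 0 < d & forall t, 0 < t < d ->
    halfplane zeta h (z + (t%:C * v1 + (t ^+ 2)%:C * v2)).
Proof.
rewrite /halfplane /= => hz.
pose B := `|phi (h.1 * v1)| + `|phi (h.1 * v2)| + 1.
have B0 : 0 < B by rewrite ltr_wpDl // addr_ge0.
exists (Num.min 1 ((phi (h.1 * z) - h.2) / B)).
  by rewrite lt_min ltr01 divr_gt0 // subr_gt0.
move=> t /andP[t0]; rewrite lt_min => /andP[t1]; rewrite ltr_pdivlMr // => tB.
rewrite !mulrDr !(mulrCA h.1) !zeta_coordD !zeta_coordZ.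
have h1 : - (t * `|phi (h.1 * v1)|) <= t * phi (h.1 * v1).
  by rewrite -mulrN ler_pM2l // lerNl -normrN ler_norm.
have h2 : - (t * `|phi (h.1 * v2)|) <= t ^+ 2 * phi (h.1 * v2).
  rewrite expr2 -mulrA -mulrN ler_pM2l //.
  rewrite lerNl -mulrN (le_trans (ler_norm _)) // normrM normrN gtr0_norm //.
  by rewrite ler_piMl // ltW.
move: tB; rewrite /B !mulrDr mulr1; lra.
Qed.

Lemma open_domain_near z v1 v2 : P z ->
  exists2 d : R, 0 < d & forall t, 0 < t < d ->
    P (z + (t%:C * v1 + (t ^+ 2)%:C * v2)).
Proof.
move=> /open_domainE zP.
suff [d d0 dP] : exists2 d : R, 0 < d & forall t h, 0 < t < d ->
    h \in sides zeta xi eta1 eta2 -> halfplane zeta h (z + (t%:C * v1 + (t ^+ 2)%:C * v2)).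
  by exists d => // t td; apply/open_domainE => h; exact: dP.
elim: (sides _ _ _ _) zP => [|h s IH] zP; first by exists 1.
have [d1 d10 h1] := halfplane_near v1 v2 (zP h (mem_head _ _)).
have [|d2 d20 h2] := IH; first by move=> k ks; apply: zP; rewrite inE ks orbT.
exists (Num.min d1 d2) => [|t k /andP[t0]]; first by rewrite lt_min d10.
rewrite lt_min => /andP[td1 td2]; rewrite inE => /predU1P[->|ks].
  by apply: h1; rewrite t0.
by apply: h2; rewrite ?t0.
Qed.

Local Notation admissible := (admissible beta zeta xi eta1 eta2).
Local Notation chain := (chain beta zeta xi eta1 eta2).

Lemma admissible_chain (w : nat -> R[i]) n :
  admissible (mkseq w n) -> exists z, chain n w z.
Proof.
move=> [z [zX zgen] [k wE]].
have zP i : P (iter i T z).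
  apply: not_boundary_open => //; first exact: iter_rbeta_map_domain.
  move=> zb; apply: zgen; case: i zb => [|i] zb; first by exists 0.
  by exists (Negz i).
exists (fun i => iter (k + i) T z); split=> [i _|i ni]; first exact: zP.
have -> : w i = digit (iter (k + i) T z).
  have := congr1 (fun s => nth 0 s i) wE.
  by rewrite size_mkseq !nth_mkseq.
by rewrite addnS.
Qed.

(** The orbit of a parabola point follows the chain at distance O(t), so it stays
    in the open parallelogram and has the same digits for small t; some small t
    is generic. *)
Lemma chain_admissible (w : nat -> R[i]) n z :
  (forall i, (i < n)%N -> lattice (w i)) -> chain n w z -> admissible (mkseq w n).
Proof.
move=> wL [zP zw].
pose pz i t := z i + (t%:C * ((beta%:C * zeta) ^+ i * eta1) +
                      (t ^+ 2)%:C * ((beta%:C * zeta) ^+ i * eta2)).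
have [d d0 dP] : exists2 d : R, 0 < d & forall t i, 0 < t < d -> (i <= n)%N -> P (pz i t).
  elim: n {wL zw} zP => [|n IH] zP.
    have [d d0 dP] := open_domain_near ((beta%:C * zeta) ^+ 0 * eta1)
       ((beta%:C * zeta) ^+ 0 * eta2) (zP 0%N (leqnn _)).
    by exists d => // t i td; rewrite leqn0 => /eqP ->; exact: dP.
  have [|d1 d10 h1] := IH; first by move=> i ni; apply: zP; exact: leqW.
  have [d2 d20 h2] := open_domain_near ((beta%:C * zeta) ^+ n.+1 * eta1)
       ((beta%:C * zeta) ^+ n.+1 * eta2) (zP n.+1 (leqnn _)).
  exists (Num.min d1 d2) => [|t i /andP[t0]]; first by rewrite lt_min d10.
  rewrite lt_min => /andP[td1 td2]; rewrite leq_eqVlt ltnS => /predU1P[->|ni].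
    by apply: h2; rewrite t0.
  by apply: h1; rewrite ?t0.
have [t [td tgen]] := exists_generic_parameter (z 0%N) d0.
have p0 : parabola (z 0%N) t = pz 0%N t by rewrite /pz !expr0 !mul1r.
have pS i : (i < n)%N -> pz i.+1 t = branch (w i) (pz i t).
  by move=> ni; rewrite /pz zw // /branch !exprS; ring.
have pX i : (i <= n)%N -> X (pz i t).
  by move=> ni; apply: (open_domain_sub zeta_im eta_indep); exact: dP.
have pdigit i : (i < n)%N -> digit (pz i t) = w i.
  by move=> ni; apply: digit_branch; rewrite -?pS //; [exact: wL|exact: pX].
have orbit i : (i <= n)%N -> iter i T (parabola (z 0%N) t) = pz i t.
  elim: i => [|i IH] ni; first exact: p0.
  by rewrite iterS IH ?(ltnW ni) // pS // /rbeta_map pdigit.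
exists (parabola (z 0%N) t); first by split=> //; rewrite p0; exact: pX.
exists 0%N; rewrite size_mkseq; apply/eq_in_map => i; rewrite mem_iota add0n => /andP[_ ni].
by rewrite /expansion add0n orbit ?(ltnW ni) // pdigit.
Qed.

End Generic.

(** * Sofic systems from finite windows *)

Lemma ultra_fintype (T : Type) (F : set_system T) (UF : UltraFilter F)
    (E : finType) (f : T -> E) : exists e : E, F (f @^-1` [set e]).
Proof.
apply: contrapT => /forallNP nF.
have : F [set t | forall e, (~` (f @^-1` [set e])) t].
  apply: filter_forall => e.
  by case: (in_ultra_setVsetC (f @^-1` [set e]) UF) => // /nF.
by move=> /filter_ex[t /(_ (f t))]; apply.
Qed.

(** A form of Koenig's lemma.  The value at i is the one taken by p_n(i) for
    almost all n, in the sense of an ultrafilter finer than n --> oo; each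
    condition involves two values only, so it holds for almost all n. *)
Lemma int_compactness (E : finType) (Q : int -> E -> E -> Prop) :
  (forall n : nat, exists p : int -> E,
     forall i : int, (absz i < n)%N -> Q i (p i) (p (i + 1))) ->
  exists p : int -> E, forall i, Q i (p i) (p (i + 1)).
Proof.
move=> /choice[p pP].
have [F [UF oF]] := @ultraFilterLemma nat \oo _.
have /choice[q qF] : forall i, exists e, F ((fun n => p n i) @^-1` [set e]).
  by move=> i; exact: ultra_fintype.
exists q => i.
have oF' : F [set n | (absz i < n)%N].
  by apply: oF; exists (absz i).+1.
have PF : ProperFilter F := ultra_proper.
have [n [[/= <- <-] ni]] := filter_ex (filterI (filterI (qF i) (qF (i + 1))) oF').
exact: pP.
Qed.

(** Compactness is applied to sequences of vertices; an edge is then a triple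
    (source, letter, target). *)
Lemma sofic_of_windows (L : choiceType) (A : set L) (S : set (int -> L))
    (V : finType) (tr : V -> L -> V -> Prop) :
  finite_set A ->
  (forall w, S w <-> (forall j, A (w j)) /\ forall (j : int) (n : nat),
     exists v : nat -> V,
       forall i : nat, (i < n)%N -> tr (v i) (w (j + i%:Z)) (v i.+1)) ->
  sofic A S.
Proof.
move=> /finite_seqP[s As] SP.
pose T : finType := (V * seq_sub s * V)%type.
pose ok : pred T := fun e => `[< tr e.1.1 (val e.1.2) e.2 >].
pose E : finType := {e : T | ok e}.
pose G := @LabeledGraph L V E (fun e => (val e).1.1) (fun e => (val e).2)
  (fun e => val (val e).1.2).
exists G; split=> [e|w]; first by rewrite As /=; exact: valP (val e).1.2.
rewrite SP; split=> [[wA wV]|[p pG pw]].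
- have [|q qP] := @int_compactness V (fun i a b => tr a (w i) b).
    move=> n; have [v vP] := wV (- n%:Z) (n + n)%N.
    exists (fun i => v (absz (i + n%:Z))) => i ni.
    have [k -> kn] : exists2 k : nat, i = - n%:Z + k%:Z & (k < n + n)%N.
      by exists (absz (i + n%:Z)); lia.
    rewrite (_ : absz (- n%:Z + k%:Z + n%:Z) = k); last by lia.
    rewrite (_ : absz (- n%:Z + k%:Z + 1 + n%:Z) = k.+1); last by lia.
    exact: vP.
  have ws i : w i \in s by have := wA i; rewrite As.
  have okP i : ok (q i, SeqSub (ws i), q (i + 1)) by apply/asboolP; exact: qP.
  by exists (fun i => Sub (_, _, _) (okP i) : E).
- split=> [j|j n]; first by rewrite -pw As /=; exact: valP (val (p j)).1.2.
  exists (fun i => source (p (j + i%:Z))) => i _.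
  rewrite -pw (_ : source (p (j + i.+1%:Z)) = target (p (j + i%:Z))).
    exact: asboolW (valP (p (j + i%:Z))).
  by rewrite pG; congr (source (p _)); lia.
Qed.

(** * Soficness of the rotational beta transformation *)

Section Soficness.
Variables (R : realType) (beta : R) (zeta xi eta1 eta2 : R[i]).
Hypothesis zeta_unit : zeta * zeta^*%C = 1.
Hypothesis zeta_12 : zeta ^+ 12 = 1.
Hypothesis zeta_trace : exists t : int, zeta + zeta^*%C = t%:~R.
Hypothesis zeta_im : complex.Im zeta != 0.
Hypothesis eta_indep : eta1 / eta2 \isn't Num.real.
Hypothesis beta_pisot : pisot beta.
Local Notation phi := (zeta_coord zeta).
Local Notation Q := (rat_poly_values beta).
Local Notation K := (quad_ext Q zeta).
Hypothesis xi_K : xi \in K.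
Hypothesis eta1_K : eta1 \in K.
Hypothesis eta2_K : eta2 \in K.
Local Notation X := (fundamental_domain xi eta1 eta2).
Local Notation dual1 := (dual1 zeta eta1 eta2).
Local Notation dual2 := (dual2 zeta eta1 eta2).
Local Notation sides := (sides zeta xi eta1 eta2).
Local Notation T := (rbeta_map beta zeta xi eta1 eta2).
Local Notation alphabet := (alphabet beta zeta xi eta1 eta2).

Let beta_gt0 : 0 < beta.
Proof. by case: beta_pisot => b1 _ _; exact: lt_trans ltr01 b1. Qed.
Let Qdiv : GRing.divring_closed Q.
Proof. by apply: rat_poly_values_divring; case: beta_pisot. Qed.
Let Q1 : 1 \in Q. Proof. by case: Qdiv. Qed.
Let QB a b : a \in Q -> b \in Q -> a - b \in Q.
Proof. by case: Qdiv => _ h _; exact: h. Qed.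
Let QN a : a \in Q -> - a \in Q.
Proof. by move=> aQ; rewrite -[- a]sub0r QB // -(subrr 1) QB. Qed.
Let KM u v : u \in K -> v \in K -> u * v \in K := quad_extM Qdiv zeta_unit zeta_trace (u:=u) (v:=v).

Lemma rat_poly_values_int (m : int) : m%:~R \in Q.
Proof. by apply/asboolP; exists (m%:~R); rewrite rmorph_int -(rmorph_int (@polyC R)) hornerC. Qed.

(** A digit is the difference of beta zeta z and a point of the parallelogram,
    so its two integer coordinates are bounded. *)
Lemma alphabet_finite : finite_set alphabet.
Proof.
pose b := beta * linear_bound zeta xi eta1 eta2 (dual1 * zeta) + linear_bound zeta xi eta1 eta2 dual1 +
  (beta * linear_bound zeta xi eta1 eta2 (dual2 * zeta) + linear_bound zeta xi eta1 eta2 dual2).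
have lb0 u : 0 <= linear_bound zeta xi eta1 eta2 u by rewrite !addr_ge0.
pose N := Num.bound b.
pose digits := [seq (i%:Z - N%:Z)%R : int | i <- iota 0 (N + N)].
have digitsP (m : int) : `|m%:~R : R| <= b -> m \in digits.
  move=> mb; have : `|m%:~R : R| < N%:R.
    by apply: le_lt_trans mb _; apply: archi_boundP; rewrite !addr_ge0 ?mulr_ge0 // ltW.
  rewrite -intr_norm -[N%:R]/(N%:Z%:~R) ltr_int => mN.
  apply/mapP; exists (absz (m + N%:Z)); last by move: mN; clear; lia.
  by rewrite mem_iota; move: mN; clear; lia.
have bound u z : X z -> `|phi (u * digit beta zeta xi eta1 eta2 z)| <=
    beta * linear_bound zeta xi eta1 eta2 (u * zeta) + linear_bound zeta xi eta1 eta2 u.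
  move=> zX; have -> : u * digit beta zeta xi eta1 eta2 z =
      beta%:C * (u * zeta * z) - u * T z by rewrite /rbeta_map; ring.
  rewrite zeta_coordB zeta_coordZ (le_trans (ler_normB _ _)) // lerD //.
    by rewrite normrM gtr0_norm // ler_pM2l // le_linear_bound.
  by rewrite le_linear_bound //; case: (digitP beta xi zeta_im eta_indep z).
suff sub : alphabet `<=` [set` [seq lattice_pt eta1 eta2 (m, n) | m <- digits, n <- digits]].
  exact: sub_finite_set sub (finite_seq _).
move=> _ [z zX <-]; have [[m [n dE]] _] := digitP beta xi zeta_im eta_indep z.
have [h11 h12 h21 h22] := dual_values zeta_im eta_indep.
have iC (k : int) (u : R[i]) : k%:~R * u = (k%:~R : R)%:C * u by rewrite rmorph_int.
apply/allpairsP; exists (m, n); split=> //; apply: digitsP.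
- rewrite (_ : m%:~R = phi (dual1 * digit beta zeta xi eta1 eta2 z)).
    by rewrite (le_trans (bound dual1 z zX)) // lerDl addr_ge0 ?mulr_ge0 // ltW.
  by rewrite dE !iC mulrDr zeta_coordD !(mulrCA dual1) !zeta_coordZ h11 h12 mulr1 mulr0 addr0.
- rewrite (_ : n%:~R = phi (dual2 * digit beta zeta xi eta1 eta2 z)).
    by rewrite (le_trans (bound dual2 z zX)) // lerDr addr_ge0 ?mulr_ge0 // ltW.
  by rewrite dE !iC mulrDr zeta_coordD !(mulrCA dual2) !zeta_coordZ h21 h22 mulr1 mulr0 add0r.
Qed.

Lemma alphabet_lattice d : alphabet d -> lattice eta1 eta2 d.
Proof. by move=> [z _ <-]; case: (digitP beta xi zeta_im eta_indep z). Qed.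

Lemma lattice_field d : lattice eta1 eta2 d -> d \in K.
Proof.
move=> [m [n ->]].
have iK (k : int) : (k%:~R : R[i]) \in K.
  by rewrite -(rmorph_int (real_complex R)); apply: quad_ext_real => //; exact: rat_poly_values_int.
have -> : m%:~R * eta1 + n%:~R * eta2 = m%:~R * eta1 - (-1)%:~R * n%:~R * eta2.
  by rewrite rmorphN rmorph1; ring.
by apply: quad_extB => //; rewrite !KM.
Qed.

Lemma dual_field : dual1 \in K /\ dual2 \in K.
Proof.
by rewrite /dual1 /dual2; split; rewrite KM ?(quad_extV Qdiv) //
  ?(quad_ext_real _ Qdiv) ?(quad_ext_coord zeta_im) ?KM ?quad_ext_conj.
Qed.

(** The orbits of the normals of the four sides under rotation by zeta^(-1);
    twelve powers are enough because 3, 4 and 6 divide 12. *)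
Definition normals : seq R[i] :=
  [seq u * zeta^*%C ^+ j | u <- [:: dual1; - dual1; dual2; - dual2], j <- iota 0 12].

Lemma normals_rot u : u \in normals -> u * zeta^*%C \in normals.
Proof.
have z12 : zeta^*%C ^+ 12 = 1.
  by rewrite -[LHS]mul1r -[1 in LHS]zeta_12 -exprMn zeta_unit expr1n.
move=> /allpairsP[[a j] [aS j12 ->]] /=; rewrite -mulrA -exprSr.
have {}j12 : (j < 12)%N by move: j12; rewrite mem_iota.
have [j11|j11] := ltnP j.+1 12.
  by apply/allpairsP; exists (a, j.+1); split=> //; rewrite mem_iota.
apply/allpairsP; exists (a, 0%N); split=> //=.
by rewrite (_ : j.+1 = 12%N) ?z12 ?expr0 //; apply/eqP; rewrite eqn_leq j12.
Qed.

Lemma normals_sides h : h \in sides -> h.1 \in normals.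
Proof.
move=> hs; apply/allpairsP; exists (h.1, 0%N); split=> //=; last by rewrite expr0 mulr1.
by move: hs; rewrite !inE => /or4P[] /eqP -> /=; rewrite eqxx ?orbT.
Qed.

Lemma normals_field u : u \in normals -> u \in K.
Proof.
have [d1 d2] := dual_field.
have NK v : v \in K -> - v \in K.
  by move=> vK; rewrite -sub0r (quad_extB Qdiv) // -(subrr v) (quad_extB Qdiv).
move=> /allpairsP[[a j] [aS _ ->]] /=.
have aK : a \in K by rewrite !inE /= in aS; case/or4P: aS => /eqP ->; rewrite ?NK.
elim: j {aS} => [|j IH]; first by rewrite expr0 mulr1.
by rewrite exprSr mulrA KM // quad_ext_conj // quad_ext_gen.
Qed.

Lemma sides_field h : h \in sides -> h.2 \in Q.
Proof.
have [d1 d2] := dual_field.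
have Q' u : u \in K -> phi (u * xi) \in Q.
  by move=> uK; apply: (quad_ext_coord zeta_im); exact: KM.
by move=> hs; rewrite !inE in hs; case/or4P: hs => /eqP -> /=; rewrite ?QB ?QN ?Q'.
Qed.

Lemma normc_real (x : R) : `|x%:C| = `|x|%:C :> R[i].
Proof. by rewrite normc_def /= expr0n addr0 sqrtr_sqr. Qed.

(** Every threshold and every translation term phi (u d) belongs to Q(beta), so
    the finiteness of bounded orbits applies to them. *)
Lemma exists_constants (C : R) : (forall h, h \in sides -> `|h.2| <= C) -> 0 <= C ->
  exists Lam : seq R, (forall h, h \in sides -> h.2 \in Lam) /\
    forall d u c, alphabet d -> u \in normals -> c \in Lam ->
      `|beta * c - phi (u * zeta^*%C * d)| <= C ->
      beta * c - phi (u * zeta^*%C * d) \in Lam.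
Proof.
move=> sC C0; have /finite_seqP[s As] := alphabet_finite.
pose E := [seq h.2 | h <- sides] ++ [seq phi (u * zeta^*%C * d) | u <- normals, d <- s].
have EQ e : e \in [seq x%:C | x <- E] ->
    exists q : {poly rat}, e = (map_poly ratr q).[beta%:C].
  move=> /mapP[x xE ->].
  have /asboolP[q ->] : x \in Q.
    move: xE; rewrite mem_cat => /orP[/mapP[h hs ->]|]; first exact: sides_field.
    move=> /allpairsP[[u d] /= [uU ds ->]]; apply: (quad_ext_coord zeta_im).
    apply: KM; last by apply/lattice_field/alphabet_lattice; rewrite As.
    by apply: KM; [exact: normals_field|apply: quad_ext_conj => //; exact: quad_ext_gen].
  exists q; rewrite -horner_map -map_poly_comp; congr horner.
  by apply: eq_map_poly => r /=; exact: fmorph_rat.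
have C0' : 0 <= C%:C by rewrite ler0c.
have [Lam [L0 L1]] := pisot_finite_orbits beta_pisot C0' EQ.
pose LamR := [seq complex.Re c | c <- Lam & complex.Im c == 0].
have LamP c : (c \in LamR) = (c%:C \in Lam).
  apply/mapP/idP => [[z]|cL]; last by exists c%:C; rewrite ?mem_filter /= ?eqxx.
  by rewrite mem_filter; case: z => a b /= /andP[/eqP -> zL ->].
exists LamR; split=> [h hs|d u c dA uU cL cC].
  rewrite LamP; apply: L0; last by rewrite normc_real lecR sC.
  by apply: map_f; rewrite mem_cat map_f.
have nextE : (beta * c - phi (u * zeta^*%C * d))%:C =
    beta%:C * c%:C - (phi (u * zeta^*%C * d))%:C by rewrite rmorphB rmorphM.
rewrite LamP nextE; apply: L1; first by rewrite -LamP.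
  apply: map_f; rewrite mem_cat; apply/orP; right; apply: allpairs_f => //.
  by move: dA; rewrite As.
by rewrite -nextE normc_real lecR.
Qed.

Lemma rbeta_sofic_of_pisot : rbeta_sofic beta zeta xi eta1 eta2.
Proof.
have [C C0 CP] := seq_norm_bound normals (linear_bound zeta xi eta1 eta2).
have [h11 _ _ h22] := dual_values zeta_im eta_indep.
have nC u : u \in normals -> linear_bound zeta xi eta1 eta2 u <= C.
  by move=> uU; rewrite (le_trans (ler_norm _)) // CP.
have sC h : h \in sides -> `|h.2| <= C.
  move=> hs; have /nC := normals_sides hs; apply: le_trans.
  rewrite /linear_bound; move: hs; rewrite !inE => /or4P[] /eqP -> /=;
    rewrite ?mulNr ?zeta_coordN ?h11 ?h22 ?normrN ?normr1.
  - by rewrite -addrA lerDl addr_ge0.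
  - rewrite (le_trans (ler_normB _ _)) // normrN normr1 lerDl //.
  - by rewrite -addrA lerDl addr_ge0.
  - rewrite (le_trans (ler_normB _ _)) // normrN normr1 addrAC lerDl //.
have [Lam [Ls Ln]] := exists_constants sC C0.
have UB u z : u \in normals -> open_domain zeta xi eta1 eta2 z -> `|phi (u * z)| <= C.
  move=> uU /(open_domain_sub zeta_im eta_indep) zX.
  exact: le_trans (le_linear_bound zeta_im eta_indep u zX) (nC u uU).
apply: (@sofic_of_windows _ _ _ _ (@cell_step _ beta zeta xi eta1 eta2 normals Lam)).
  exact: alphabet_finite.
move=> w; split=> [[wA wadm]|[wA wpath]]; split=> // j.
- move=> n; have jn : j <= j + n%:Z by rewrite lerDl.
  have := wadm j _ jn; have -> : absz (j + n%:Z - j)%R = n by rewrite addrAC subrr add0r.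
  move=> /(admissible_chain zeta_im eta_indep)[z zC].
  have [v vP] := path_of_chain zeta_unit beta_gt0 normals_rot normals_sides Ls Ln UB
     (fun i _ => wA _) zC.
  by exists v => i ni; apply: vP; exact: leqW.
- move=> k jk; have [v vP] := wpath j (absz (k - j)).+1.
  have [z zC] := chain_of_path (ltn0Sn _) vP.
  apply: (chain_admissible zeta_im eta_indep beta_gt0 _ zC) => i _.
  exact: alphabet_lattice.
Qed.

End Soficness.

Theorem corollary1p6 (R : realType) (zeta : R[i]) (beta : R)
    (xi eta1 eta2 : R[i])
    (zeta_nonreal : zeta \isn't Num.real)
    (zeta_root : [\/ 3.-unity_root zeta, 4.-unity_root zeta
                   | 6.-unity_root zeta])
    (beta_pisot : pisot beta)
    (xi_in : field_generated [set zeta; beta%:C] xi)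
    (eta1_in : field_generated [set zeta; beta%:C] eta1)
    (eta2_in : field_generated [set zeta; beta%:C] eta2)
    (eta_indep : eta1 / eta2 \isn't Num.real) :
  rbeta_sofic beta zeta xi eta1 eta2.
Proof.
have [z12 zu zt] := unity_root_trace zeta_nonreal zeta_root.
have zi := nonreal_Im zeta_nonreal.
have [_ bint _] := beta_pisot.
have Qdiv := rat_poly_values_divring bint.
have bQ : beta \in rat_poly_values beta.
  by apply/asboolP; exists 'X; rewrite map_polyX hornerX.
have sub := quad_ext_field_generated Qdiv zu zt zi bQ.
by apply: rbeta_sofic_of_pisot => //; exact: sub.
Qed.
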